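(* Let $\overline{M}$ be a smooth manifold of dimension $n+1$, with boundary $\partial M$ and interior $M$, and let $\nabla$ be a torsion-free linear connection on $TM$. Then the projective class determined by $\nabla$ admits a smooth extension to $\overline{M}$ if and only if for any point $x\in\partial M$ there is a local chart $U$ for $\overline{M}$ with $x\in U$ such that the components $\Psi^k_{ij}$ of the tracefree part of the connection coefficients of $\nabla$, with respect to the local coordinates determined by $U$, admit a smooth extension from $U\cap M$ to all of $U$.
   Context: Projective equivalence: two torsion-free linear connections $\nabla,\hat\nabla$ on the tangent bundle of a smooth manifold $N$ are projectively equivalent if there is a one-form $\Upsilon\in\Omega^1(N)$ such that $\hat\nabla_\xi\eta=\nabla_\xi\eta+\Upsilon(\xi)\eta+\Upsilon(\eta)\xi$ for all vector fields $\xi,\eta$ on $N$. A projective class (projective structure) is an equivalence class for this relation. Extension of the projective class: the projective class determined by a torsion-free linear connection $\nabla$ on $TM$ admits a smooth extension to $\overline{M}$ if for every $x\in\partial M$ there is an open neighborhood $U$ of $x$ in $\overline{M}$ and a one-form $\Upsilon\in\Omega^1(U\cap M)$ such that for all vector fields $\xi,\eta\in\mathfrak{X}(U)$ (smooth up to the boundary), the vector field $\hat\nabla_\xi\eta=\nabla_\xi\eta+\Upsilon(\xi)\eta+\Upsilon(\eta)\xi$ on $U\cap M$ admits a smooth extension to all of $U$. Tracefree part of the connection coefficients: for a chart $U$ of $\overline{M}$ with local coordinates $x^0,\dots,x^n$ and coordinate vector fields $\partial_i=\frac{\partial}{\partial x^i}$, the connection coefficients $\Gamma^k_{ij}\in C^\infty(U\cap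 M,\mathbb{R})$ of $\nabla$ are defined by $\nabla_{\partial_i}\partial_j=\sum_k\Gamma^k_{ij}\partial_k$ (they are symmetric in $i,j$). Put $\gamma_i:=\sum_k\Gamma^k_{ik}$ and $\Psi^k_{ij}:=\Gamma^k_{ij}-\frac{1}{n+2}(\gamma_i\delta^k_j+\gamma_j\delta^k_i)$; the functions $\Psi^k_{ij}$ on $U\cap M$, $i,j,k=0,\dots,n$, are the components of the tracefree part. *)

(* Defs.v *)
From HB Require Import structures.
From mathcomp Require Import all_boot all_order all_algebra.
From mathcomp Require Import all_classical all_reals all_analysis.

Set Implicit Arguments.
Unset Strict Implicit.
Unset Printing Implicit Defensive.

Import Order.TTheory GRing.Theory Num.Theory.
Import numFieldNormedType.Exports.

Local Open Scope classical_set_scope.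
Local Open Scope ring_scope.

(* Manifolds with boundary, tensor fields and linear connections.  Charts take values in the closed half space
   {x | 0 <= x^0} of R^(n+1), written 'rV[R]_n.+1 with coordinates x^i = x 0 i.
   Functions and fields that are only defined on an open subset W of a manifold
   are represented by total functions; their values outside W are irrelevant. *)

Section Euclidean.
Variables (R : realType) (n : nat).
Implicit Types (A O : set 'rV[R]_n.+1) (f g : 'rV[R]_n.+1 -> R).

Definition unit_vec (i : 'I_n.+1) : 'rV[R]_n.+1 := delta_mx 0 i.

Definition half_space : set 'rV[R]_n.+1 := [set x | 0 <= x 0 ord0].

Definition iter_partial (s : seq 'I_n.+1) f : 'rV[R]_n.+1 -> R :=
  foldr (fun i g => fun x => 'D_(unit_vec i) g x) f s.

(* C^infinity on an open set: all iterated partial derivatives exist and are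
   continuous *)
Definition smooth_open O f : Prop :=
  forall (s : seq 'I_n.+1) x, O x ->
    {for x, continuous (iter_partial s f)} /\
    forall i, derivable (iter_partial s f) x (unit_vec i).

(* smoothness on an arbitrary subset A (here always a relatively open subset of
   the half space): local existence of smooth extensions to open sets *)
Definition smooth_on A f : Prop :=
  forall x, A x -> exists O g,
    [/\ open O, O x, smooth_open O g & forall y, O y -> A y -> g y = f y].

(* i-th partial derivative relative to the half space: the usual partial
   derivative, which is one-sided for i = 0 at points with x^0 = 0 *)
Definition half_partial (i : 'I_n.+1) f (x : 'rV[R]_n.+1) : R :=
  lim ((fun h : R => h^-1 * (f (h *: unit_vec i + x) - f x)) @
         within [set h : R | half_space (h *: unit_vec i + x)] 0^').

End Euclidean.

Arguments half_space {R n}.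
Arguments unit_vec {R n}.

Record chart (R : realType) (n : nat) (T : topologicalType) := Chart {
  dom : set T;
  coord :> T -> 'rV[R]_n.+1;
  coord_inv : 'rV[R]_n.+1 -> T;
  dom_open : open dom;
  coord_invK : forall p, dom p -> coord_inv (coord p) = p;
  coord_image_open :
    exists2 O, open O & coord @` dom = O `&` half_space;
  coord_continuous : {within dom, continuous coord};
  coord_inv_continuous : {within coord @` dom, continuous coord_inv} }.

Definition smooth_in_chart (R : realType) (n : nat) (T : topologicalType)
    (c : chart R n T) (W : set T) (f : T -> R) : Prop :=
  smooth_on (c @` (dom c `&` W)) (f \o coord_inv c).

Definition compatible (R : realType) (n : nat) (T : topologicalType)
    (c c' : chart R n T) : Prop :=
  forall i, smooth_in_chart c (dom c') (fun p => c' p 0 i).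

(* smooth manifolds of dimension n + 1 with (possibly empty) boundary *)
Record manifold (R : realType) (n : nat) := Manifold {
  space :> topologicalType;
  atlas : set (chart R n space);
  space_hausdorff : hausdorff_space space;
  space_second_countable : @second_countable space;
  atlas_cover : forall p, exists2 c, atlas c & dom c p;
  atlas_compatible : forall c c', atlas c -> atlas c' -> compatible c c';
  atlas_maximal : forall c,
    (forall c', atlas c' -> compatible c c' /\ compatible c' c) -> atlas c }.

Section Manifold.
Variables (R : realType) (n : nat) (M : manifold R n).
Local Notation chartM := (chart R n M).
Implicit Types (c : chartM) (p : M) (W U : set M) (f : M -> R) (i j k : 'I_n.+1).

Definition interior_points : set M :=
  [set p | exists c, [/\ atlas c, dom c p & 0 < c p 0 ord0]].

Definition boundary_points : set M :=
  [set p | exists c, [/\ atlas c, dom c p & c p 0 ord0 = 0]].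

Definition smooth_fun W f : Prop :=
  forall c, atlas c -> smooth_in_chart c W f.

(* (d f / d x^i) (p), for the coordinates x^i of the chart c *)
Definition partial c i f p : R := half_partial i (f \o coord_inv c) (c p).

(* A tangent vector (covector) at p is a family of coordinate vectors, one for
   each chart of the atlas around p, with the usual transformation law.  A field
   assigns to a chart c and a point p the components at p with respect to c;
   only the charts of the atlas whose domain contains p matter. *)
Definition field : Type := chartM -> M -> 'rV[R]_n.+1.
Implicit Types (xi eta zeta Ups : field).

Definition smooth_field W xi : Prop :=
  forall c, atlas c -> forall i, smooth_in_chart c W (fun p => xi c p 0 i).

Definition vector_field W xi : Prop :=
  smooth_field W xi /\
  forall c c' p, atlas c -> atlas c' -> dom c p -> dom c' p -> W p ->
    forall k, xi c' p 0 k =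
      \sum_i xi c p 0 i * partial c i (fun q => c' q 0 k) p.

Definition one_form W Ups : Prop :=
  smooth_field W Ups /\
  forall c c' p, atlas c -> atlas c' -> dom c p -> dom c' p -> W p ->
    forall i, Ups c p 0 i =
      \sum_k partial c i (fun q => c' q 0 k) p * Ups c' p 0 k.

Definition field_eq W xi eta : Prop :=
  forall c p, atlas c -> dom c p -> W p -> xi c p = eta c p.

Definition field_add xi eta : field := fun c p => xi c p + eta c p.

Definition field_scale f xi : field := fun c p => f p *: xi c p.

(* The next three are scalars, resp. components, computed in the chart c; the
   transformation laws make them independent of c, resp. a vector field. *)
Definition pairing Ups xi c p : R := \sum_i Ups c p 0 i * xi c p 0 i.

Definition dir_deriv xi f c p : R := \sum_i xi c p 0 i * partial c i f p.

Definition lie_bracket xi eta : field := fun c p =>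
  \row_k (dir_deriv xi (fun q => eta c q 0 k) c p -
          dir_deriv eta (fun q => xi c q 0 k) c p).

(* the coordinate vector field d/dx^i of the chart c, given by its components
   with respect to all charts c' *)
Definition coord_field c i : field := fun c' p =>
  \row_k partial c i (fun q => c' q 0 k) p.

(* Linear connections on the tangent bundle of the interior, as operators on
   local sections: nabla xi eta is a vector field on every open subset W of the
   interior on which xi and eta are vector fields.  conn_local says that it
   depends on xi and eta over W only; applied to smaller open sets it says that
   nabla commutes with restrictions. *)
Record connection := Connection {
  nabla :> field -> field -> field;
  conn_vector_field : forall W xi eta, open W -> W `<=` interior_points ->
    vector_field W xi -> vector_field W eta -> vector_field W (nabla xi eta);
  conn_local : forall W xi xi' eta eta', open W -> W `<=` interior_points ->
    vector_field W xi -> vector_field W xi' ->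
    vector_field W eta -> vector_field W eta' ->
    field_eq W xi xi' -> field_eq W eta eta' ->
    field_eq W (nabla xi eta) (nabla xi' eta');
  conn_addl : forall W xi xi' eta, open W -> W `<=` interior_points ->
    vector_field W xi -> vector_field W xi' -> vector_field W eta ->
    field_eq W (nabla (field_add xi xi') eta)
               (field_add (nabla xi eta) (nabla xi' eta));
  conn_scalel : forall W f xi eta, open W -> W `<=` interior_points ->
    smooth_fun W f -> vector_field W xi -> vector_field W eta ->
    field_eq W (nabla (field_scale f xi) eta) (field_scale f (nabla xi eta));
  conn_addr : forall W xi eta eta', open W -> W `<=` interior_points ->
    vector_field W xi -> vector_field W eta -> vector_field W eta' ->
    field_eq W (nabla xi (field_add eta eta'))
               (field_add (nabla xi eta) (nabla xi eta'));
  conn_leibniz : forall W f xi eta, open W -> W `<=` interior_points ->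
    smooth_fun W f -> vector_field W xi -> vector_field W eta ->
    field_eq W (nabla xi (field_scale f eta))
               (fun c p => f p *: nabla xi eta c p +
                           dir_deriv xi f c p *: eta c p) }.

Definition torsion_free (D : connection) : Prop :=
  forall W xi eta, open W -> W `<=` interior_points ->
    vector_field W xi -> vector_field W eta ->
    field_eq W (fun c p => D xi eta c p - D eta xi c p) (lie_bracket xi eta).

(* nabla_xi eta + Ups(xi) eta + Ups(eta) xi *)
Definition projective_change (D : connection) Ups xi eta : field :=
  fun c p => D xi eta c p + pairing Ups xi c p *: eta c p
                          + pairing Ups eta c p *: xi c p.

Definition projective_class_extends (D : connection) : Prop :=
  forall x, boundary_points x -> exists U Ups,
    [/\ open U, U x, one_form (U `&` interior_points) Ups &
      forall xi eta, vector_field U xi -> vector_field U eta ->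
        exists2 zeta, vector_field U zeta &
          field_eq (U `&` interior_points) zeta
                   (projective_change D Ups xi eta)].

(* Gamma^k_ij : the coefficient of d/dx^k in nabla_{d/dx^i} d/dx^j is the k-th
   component of this field with respect to c itself *)
Definition conn_coef (D : connection) c k i j p : R :=
  D (coord_field c i) (coord_field c j) c p 0 k.

Definition conn_trace (D : connection) c i p : R :=
  \sum_k conn_coef D c k i k p.

(* Psi^k_ij *)
Definition tracefree_coef (D : connection) c k i j p : R :=
  conn_coef D c k i j p -
  (n.+2)%:R^-1 * (conn_trace D c i p * (k == j)%:R +
                  conn_trace D c j p * (k == i)%:R).

Definition extends_smoothly U f : Prop :=
  exists2 g, smooth_fun U g & forall p, U p -> interior_points p -> g p = f p.

End Manifold.

Arguments interior_points {R n} M.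
Arguments boundary_points {R n} M.

(* Main.v *)
From HB Require Import structures.
Require Import Defs.
From mathcomp Require Import all_boot all_order all_algebra.
From mathcomp Require Import all_classical all_reals all_analysis.
From mathcomp Require Import ring.

Set Implicit Arguments.
Unset Strict Implicit.
Unset Printing Implicit Defensive.

Import Order.TTheory GRing.Theory Num.Theory.
Import numFieldNormedType.Exports.

Local Open Scope classical_set_scope.
Local Open Scope ring_scope.

(** In a chart, a projective change by [Upsilon] replaces the connection
    coefficients [Gamma^k_ij] by [Gamma^k_ij + Upsilon_i delta^k_j + Upsilon_j delta^k_i],
    hence their trace [gamma_i] by [gamma_i + (n+2) Upsilon_i]: the tracefree part
    [Psi^k_ij] does not change ([tracefree_coef_change]).

    If the projective class extends near a boundary point [x], apply the extension
    property to the coordinate fields of a chart.  They are only defined on the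
    domain of the chart, so they are first multiplied by a cutoff function equal to
    [1] near [x] ([cutoff]).  Near [x] the components of the resulting fields are the
    changed coefficients; they are smooth up to the boundary, and [Psi^k_ij] is the
    tracefree part of them ([projective_extends_tracefree]).

    Conversely, suppose that the [Psi^k_ij] extend smoothly to the domain of a chart.
    The one-form [Upsilon] with components [- gamma_i / (n+2)] in this chart changes
    the coefficients precisely to [Psi^k_ij], so by [conn_in_chart] the changed
    derivative of [eta] along [xi] has the components
    [sum_i xi^i (d_i eta^k + sum_j Psi^k_ij eta^j)], which extend smoothly
    ([tracefree_extends_projective]).

    Both directions rest on calculus up to the boundary of the half space.  Smooth
    functions there are locally restrictions of functions all of whose iterated
    partial derivatives exist and are continuous.  Continuity of the partial
    derivatives gives differentiability ([C1_differentiable]), from which follow the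
    chain rule, the stability of smoothness under composition ([Ck_comp],
    [smooth_on_comp]), and the chain rule for the one-sided partial derivatives
    ([half_partial_comp]).  The latter gives the transformation laws under a change of
    charts ([partial_chain]).  Cutoff functions are built from [exp(-1/t)] ([flat],
    [bump]). *)

(** * Differentiability and the chain rule *)

(** Differentiability from an explicit linear approximation. *)
Lemma differentiable_intro (K : realFieldType) (V W : normedModType K) (f : V -> W)
    (L : {linear V -> W}) (x : V) :
  continuous L ->
  (forall e, 0 < e ->
     \forall v \near (0 : V), `|f (v + x) - f x - L v| <= e * `|v|) ->
  differentiable f x.
Proof.
move=> cL fL.
have fo : f \o shift x = cst (f x) + L +o_ (0 : V) id.
  apply/eqaddoP => e e0; near=> v; rewrite !fctE /= opprD addrA.
  by near: v; exact: fL.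
by apply/diff_locallyP; rewrite (diff_unique cL fo).
Unshelve. all: by end_near. Qed.

Section Differentiability.
Variables (R : realType) (n : nat).
Implicit Types (f g : 'rV[R]_n.+1 -> R) (a x v : 'rV[R]_n.+1).

(** The mean value theorem between [0] and [t], whatever the sign of [t]. *)
Lemma mvt_centered (psi dpsi : R -> R) (t : R) :
  (forall s : R, `|s| <= `|t| -> is_derive s (1 : R) psi (dpsi s)) ->
  exists2 s, `|s| <= `|t| & psi t - psi 0 = dpsi s * t.
Proof.
move=> dpsiE.
have cts (a b : R) : (forall s : R, s \in `[a, b]%R -> `|s| <= `|t|) ->
    {within `[a, b]%classic, continuous psi}.
  move=> ab; apply: derivable_within_continuous => s /ab /dpsiE ?.
  exact: ex_derive.
have [t0|t0] := leP 0 t.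
- have st s : s \in `[0, t]%R -> `|s| <= `|t|.
    by rewrite in_itv/= => /andP[s0 st]; rewrite !ger0_norm.
  have [s /st stt ->] := MVT_segment t0
    (fun s sI => dpsiE s (st s (subset_itv_oo_cc sI))) (cts _ _ st).
  by exists s; rewrite ?subr0.
- have st s : s \in `[t, 0]%R -> `|s| <= `|t|.
    by rewrite in_itv/= => /andP[s0 st]; rewrite !ler0_norm ?lerN2 // ltW.
  have [s /st stt E] := MVT_segment (ltW t0)
    (fun s sI => dpsiE s (st s (subset_itv_oo_cc sI))) (cts _ _ st).
  by exists s => //; rewrite -[LHS]opprB E sub0r mulrN opprK.
Qed.

Lemma coord_norm_le v k : `|v 0 k| <= `|v|.
Proof.
rewrite [leRHS]/Num.Def.normr/= mx_normrE.
exact: (le_bigmax _ (fun ij : 'I_1 * 'I_n.+1 => `|v ij.1 ij.2|) (0, k)).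
Qed.

Lemma norm_le_coord v (e : R) : 0 <= e -> (forall k, `|v 0 k| <= e) -> `|v| <= e.
Proof.
move=> e0 ve; rewrite [leLHS]/Num.Def.normr/= mx_normrE bigmax_le// => -[i j] _ /=.
by rewrite ord1.
Qed.

Lemma unit_vecE (i k : 'I_n.+1) : @unit_vec R n i 0 k = (k == i)%:R.
Proof. by rewrite mxE eqxx. Qed.

Lemma row_sum_unit v : v = \sum_k v 0 k *: unit_vec k.
Proof.
apply/rowP => j; rewrite summxE (bigD1 j)//= big1 => [|k kj].
  by rewrite mxE unit_vecE eqxx mulr1 addr0.
by rewrite mxE unit_vecE eq_sym (negbTE kj) mulr0.
Qed.

(** A directional derivative is a one-variable derivative along a line. *)
Lemma derive_line (W : normedModType R) (F : 'rV[R]_n.+1 -> W) x v :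
  'D_v F x = 'D_1 (fun h : R => F (h *: v + x)) 0.
Proof.
rewrite /derive; congr (lim (_ @ 0^')); apply/funext => h /=.
by rewrite addr0 scale0r add0r [h *: 1]mulr1.
Qed.

Lemma is_derive_line g (w v : 'rV[R]_n.+1) (s : R) :
  derivable g (s *: v + w) v ->
  is_derive s (1 : R) (fun h : R => g (h *: v + w)) ('D_v g (s *: v + w)).
Proof.
have E : (fun h : R => h^-1 *:
    (((fun h : R => g (h *: v + w)) \o shift s) (h *: 1) - g (s *: v + w))) =
  (fun h : R => h^-1 *: ((g \o shift (s *: v + w)) (h *: v) - g (s *: v + w))).
  apply/funext => h /=; congr (_ *: (g _ - _)).
  by rewrite scalerDl addrA [h *: 1]mulr1.
by move=> dg; apply: DeriveDef; rewrite /derivable /derive E.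
Qed.

(** [v] with its coordinates of index at least [m] replaced by [0]: the vertices
    [trunc_vec 0 v = 0], ..., [trunc_vec n.+1 v = v] of a path from [0] to [v]
    along the coordinate axes. *)
Definition trunc_vec (m : nat) v : 'rV[R]_n.+1 :=
  \row_k if (k < m)%N then v 0 k else 0.

Lemma trunc_vec_small a v (m : 'I_n.+1) (s d : R) : 0 < d -> `|v| < d ->
  `|s| <= `|v 0 m| -> ball a d (s *: unit_vec m + (trunc_vec m v + a)).
Proof.
move=> d0 vd sv; rewrite mx_norm_ball /ball_ /= distrC addrA addrK.
apply: le_lt_trans vd; apply: norm_le_coord => // k.
rewrite 2![in leLHS]mxE unit_vecE [X in _ + X]mxE; have [km|km] := eqVneq k m.
  by rewrite km ltnn addr0 mulr1 (le_trans sv)// coord_norm_le.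
by rewrite mulr0 add0r; case: ifP; rewrite ?normr0// coord_norm_le.
Qed.

Lemma trunc_vecS v (m : 'I_n.+1) :
  trunc_vec m.+1 v = v 0 m *: unit_vec m + trunc_vec m v.
Proof.
apply/rowP => k; rewrite !mxE eqxx /= ltnS leq_eqVlt.
have [->|km] := eqVneq k m; first by rewrite eqxx ltnn mulr1 addr0.
by rewrite -val_eqE/= in km; rewrite (negbTE km) mulr0 add0r.
Qed.

(** Continuous partial derivatives give differentiability: the increment is a
    telescoping sum of increments along the coordinate axes, each of which is
    controlled by the mean value theorem. *)
Lemma C1_differentiable g a :
  (forall i, \forall x \near a, derivable g x (unit_vec i)) ->
  (forall i, {for a, continuous ('D_(unit_vec i) g)}) ->
  differentiable g a.
Proof.
move=> dg cg.
pose L v := \sum_i v 0 i * 'D_(unit_vec i) g a.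
have linL : linear L.
  move=> c u v; rewrite /L scaler_sumr -big_split; apply: eq_bigr => i _ /=.
  by rewrite !mxE mulrDl scalerAl.
pose LL : {linear 'rV[R]_n.+1 -> R} :=
  HB.pack L (GRing.isLinear.Build _ _ _ _ _ linL).
have cL : continuous (LL : 'rV[R]_n.+1 -> R).
  have c1 i : continuous (fun v : 'rV[R]_n.+1 => v 0 i * 'D_(unit_vec i) g a : R).
    by move=> v; apply: (@cvgM R _ (nbhs v)); [exact: coord_continuous | exact: cvg_cst].
  by apply: continuous_big => [|i _]; [exact: add_continuous | exact: c1].
apply: (differentiable_intro cL) => e e0.
  have n0 : (0 : R) < n.+1%:R by rewrite ltr0n.
  have : \forall x \near a, forall i, derivable g x (unit_vec i) /\
      `|'D_(unit_vec i) g a - 'D_(unit_vec i) g x| <= e / n.+1%:R.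
    apply: (@filter_forall _ _ _ (nbhs a)) => i; near=> x; split; first by near: x; exact: dg.
    near: x; have /cvgrPdist_le := cg i; apply; exact: divr_gt0.
  move=> /nbhs_ballP[d /= d0 dP]; near=> v.
  have vd : `|v| < d.
    by near: v; apply/nbhs_ballP; exists d => //= v; rewrite mx_norm_ball /ball_/= sub0r normrN.
  have key (m : 'I_n.+1) :
      `|g (trunc_vec m.+1 v + a) - g (trunc_vec m v + a) - v 0 m * 'D_(unit_vec m) g a|
       <= e / n.+1%:R * `|v|.
    have := @mvt_centered (fun h => g (h *: unit_vec m + (trunc_vec m v + a)))
      (fun s => 'D_(unit_vec m) g (s *: unit_vec m + (trunc_vec m v + a))) (v 0 m).
    case=> [s sv|s sv].
      apply: is_derive_line; apply: (dP _ _ m).1; exact: trunc_vec_small.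
    rewrite scale0r add0r addrA -trunc_vecS => ->.
    rewrite [v 0 m * _]mulrC -mulrBl normrM ler_pM// ?coord_norm_le// distrC.
    by apply: (dP _ _ m).2; exact: trunc_vec_small.
  have -> : g (v + a) - g a - LL v =
    \sum_(m < n.+1) (g (trunc_vec m.+1 v + a) - g (trunc_vec m v + a) -
                      v 0 m * 'D_(unit_vec m) g a).
    rewrite sumrB -(big_mkord xpredT (fun m => g (trunc_vec m.+1 v + a) - g (trunc_vec m v + a))).
    rewrite telescope_sumr//.
    congr (g _ - g _ - _).
    - congr (_ + _); apply/rowP => k; by rewrite mxE ltn_ord.
    - by rewrite -[LHS]add0r; congr (_ + _); apply/rowP => k; rewrite !mxE.
  apply: le_trans (ler_norm_sum _ _ _) _; apply: le_trans (ler_sum _ (fun m _ => key m)) _.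
  by rewrite sumr_const card_ord -[leLHS]mulr_natr mulrAC divfK// gt_eqF.
Unshelve. all: by end_near. Qed.

Lemma derive_sum_partial g a v : differentiable g a ->
  'D_v g a = \sum_k v 0 k * 'D_(unit_vec k) g a.
Proof.
move=> dg; rewrite deriveE// {1}[v]row_sum_unit linear_sum.
by apply: eq_bigr => k _; rewrite linearZ deriveE.
Qed.

(** The outer function has to be differentiable, the inner functions only have to
    be derivable in the given direction. *)
Lemma derive_comp g (phi : 'I_n.+1 -> 'rV[R]_n.+1 -> R) x v :
  let Phi y := \row_k phi k y in
  differentiable g (Phi x) -> (forall k, derivable (phi k) x v) ->
  derivable (g \o Phi) x v /\
  'D_v (g \o Phi) x = \sum_k 'D_v (phi k) x * 'D_(unit_vec k) g (Phi x).
Proof.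
move=> Phi dg dphi.
have dPhi : derivable Phi x v.
  apply/derivable_mxP => i j; rewrite (_ : (fun _ => _) = phi j)//.
  by apply/funext => y; rewrite mxE.
have EPhi : 'D_v Phi x = \row_k 'D_v (phi k) x.
  rewrite derive_mx//; apply/rowP => k; rewrite !mxE.
  by congr ('D_v _ x); apply/funext => y; rewrite mxE.
have l0 : differentiable (fun h : R => Phi (h *: v + x)) 0.
  by apply: (iffLR (derivable1_diffP _ _)); apply: (iffLR (derivable1P _ _ _)).
have dg' : differentiable g (Phi (0 *: v + x)) by rewrite scale0r add0r.
have dgl : differentiable (g \o (fun h : R => Phi (h *: v + x))) 0.
  exact: differentiable_comp.
split.
  by apply: (iffRL (derivable1P _ _ _)); apply: (iffRL (derivable1_diffP _ _)).
rewrite derive_line deriveE// (diff_comp l0 dg') /=.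
rewrite -(deriveE _ l0) -derive_line scale0r add0r -(deriveE _ dg) derive_sum_partial// EPhi.
by apply: eq_bigr => k _; rewrite mxE.
Qed.

Lemma is_derive_comp1 (h : R -> R) g x v (a : R) :
  is_derive (g x) (1 : R) h a -> derivable g x v ->
  is_derive x v (h \o g) (a * 'D_v g x).
Proof.
move=> dh dg.
have dl : is_derive (0 : R) (1 : R) (fun s : R => g (s *: v + x)) ('D_v g x).
  by rewrite derive_line; apply: derivableP; apply: (iffLR (derivable1P _ _ _)).
have dh' : is_derive (g ((0 : R) *: v + x)) (1 : R) h a by rewrite scale0r add0r.
have [dc dcE] := @is_derive1_comp R h (fun s : R => g (s *: v + x)) 0 _ _ dh' dl.
apply: DeriveDef; first by apply: (iffRL (derivable1P _ _ _)).
by rewrite derive_line -dcE.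
Qed.

End Differentiability.

(** * Functions of class C^r on open sets *)

Section Smoothness.
Variables (R : realType) (n : nat).
Implicit Types (f g : 'rV[R]_n.+1 -> R) (x : 'rV[R]_n.+1) (O : set 'rV[R]_n.+1).

(** [Ck r O f]: the iterated partial derivatives of [f] of order at most [r]
    exist and are continuous on the open set [O]. *)
Fixpoint Ck (r : nat) O f : Prop :=
  (forall x, O x -> {for x, continuous f}) /\
  if r is r'.+1 then
    forall i, (forall x, O x -> derivable f x (unit_vec i)) /\
              Ck r' O ('D_(unit_vec i) f)
  else True.

Lemma iter_partial_rcons s i f :
  iter_partial (rcons s i) f = iter_partial s ('D_(unit_vec i) f).
Proof. by rewrite /iter_partial foldr_rcons. Qed.

Lemma smooth_openP O f : smooth_open O f <-> forall r, Ck r O f.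
Proof.
split=> [fs r|fC s x Ox].
  elim: r f fs => [|r IHr] f fs; (split; first by move=> x Ox; exact: (fs [::] x Ox).1) => // i.
  split=> [x Ox|]; first exact: (fs [::] x Ox).2.
  by apply: IHr => s x Ox; have := fs (rcons s i) x Ox; rewrite iter_partial_rcons.
elim/last_ind: s f fC => [|s i IHs] f fC.
  by split=> [|i]; [exact: (fC 0%N).1 | exact: ((fC 1%N).2 i).1].
by rewrite iter_partial_rcons; apply: IHs => r; exact: ((fC r.+1).2 i).2.
Qed.

Lemma Ck_continuous r O f x : Ck r O f -> O x -> {for x, continuous f}.
Proof. by case: r => [|r] [fc _]; exact: fc. Qed.

Lemma Ck_pred r O f : Ck r.+1 O f -> Ck r O f.
Proof.
elim: r f => [|r IHr] f [fc fd]; split=> // i.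
by have [fdi /IHr fCi] := fd i.
Qed.

Lemma Ck_differentiable r O f x : open O -> Ck r.+1 O f -> O x ->
  differentiable f x.
Proof.
move=> oO [_ fd] Ox; apply: C1_differentiable => i.
  by near do apply: (fd i).1; exact: open_nbhs_nbhs.
exact: Ck_continuous (fd i).2 Ox.
Unshelve. all: by end_near. Qed.

Lemma near_open_eq O f g x : open O -> O x -> (forall y, O y -> f y = g y) ->
  {near x, f =1 g}.
Proof. by move=> oO Ox fg; near do apply: fg; exact: open_nbhs_nbhs.
Unshelve. all: by end_near. Qed.

Lemma derive_eq_on O f g x v : open O -> O x -> (forall y, O y -> f y = g y) ->
  'D_v f x = 'D_v g x.
Proof. by move=> oO Ox fg; apply: near_eq_derive; exact: near_open_eq fg. Qed.

Lemma continuous_eq_on O f g x : open O -> O x -> (forall y, O y -> f y = g y) ->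
  {for x, continuous f} -> {for x, continuous g}.
Proof.
move=> oO Ox fg fc; rewrite /prop_for /continuous_at -(fg x Ox).
apply: cvg_trans fc; apply: (@near_eq_cvg _ _ (nbhs x)).
exact: near_open_eq oO Ox fg.
Qed.

Lemma Ck_eq r O f g : open O -> (forall x, O x -> f x = g x) ->
  Ck r O f -> Ck r O g.
Proof.
move=> oO; elim: r f g => [|r IHr] f g fg [fc fd];
  (split; first by move=> x Ox; exact: continuous_eq_on fg (fc x Ox)) => // i.
have [fdi fCi] := fd i; split=> [x Ox|].
  by apply: near_eq_derivable (fdi x Ox); exact: near_open_eq fg.
by apply: IHr fCi => x Ox; exact: derive_eq_on Ox fg.
Qed.

Lemma Ck_subset r O O' f : O' `<=` O -> Ck r O f -> Ck r O' f.
Proof.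
move=> sO; elim: r f => [|r IHr] f [fc fd];
  (split; first by move=> x /sO /fc) => // i.
by have [fdi fCi] := fd i; split=> [x /sO /fdi|]//; exact: IHr.
Qed.

Lemma Ck_cst r O (c : R) : Ck r O (fun=> c).
Proof.
elim: r c => [|r IHr] c; (split; first by move=> x _; exact: cst_continuous) => // i.
split=> [x _|]; first exact: derivable_cst.
rewrite (_ : 'D__ _ = fun=> 0); first exact: IHr.
by apply/funext => x; exact: derive_cst.
Qed.

Lemma CkD r O f g : open O -> Ck r O f -> Ck r O g -> Ck r O (fun x => f x + g x).
Proof.
move=> oO; elim: r f g => [|r IHr] f g [fc fd] [gc gd];
  (split; first by move=> x Ox; exact: continuousD (fc x Ox) (gc x Ox)) => // i.
have [fdi fCi] := fd i; have [gdi gCi] := gd i.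
split=> [x Ox|]; first exact: derivableD (fdi x Ox) (gdi x Ox).
apply: Ck_eq (IHr _ _ fCi gCi) => // x Ox; apply/esym.
exact: deriveD (fdi x Ox) (gdi x Ox).
Qed.

Lemma CkM r O f g : open O -> Ck r O f -> Ck r O g -> Ck r O (fun x => f x * g x).
Proof.
move=> oO; elim: r f g => [|r IHr] f g fC gC; have [fc fd] := fC; have [gc gd] := gC;
  (split; first by move=> x Ox; exact: continuousM (fc x Ox) (gc x Ox)) => // i.
have [fdi fCi] := fd i; have [gdi gCi] := gd i.
split=> [x Ox|]; first exact: derivableM (fdi x Ox) (gdi x Ox).
apply: Ck_eq (CkD oO (IHr _ _ (Ck_pred fC) gCi) (IHr _ _ (Ck_pred gC) fCi)) => // x Ox.
exact/esym/(deriveM (fdi x Ox) (gdi x Ox)).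
Qed.

Lemma Ck_sum r O (I : Type) (s : seq I) (F : I -> 'rV[R]_n.+1 -> R) : open O ->
  (forall i, Ck r O (F i)) -> Ck r O (fun x => \sum_(i <- s) F i x).
Proof.
move=> oO FC; elim: s => [|i s IHs].
  by apply: Ck_eq (Ck_cst r O 0) => // x _; rewrite big_nil.
by apply: Ck_eq (CkD oO (FC i) IHs) => // x _; rewrite big_cons.
Qed.

Lemma is_derive_coord k x v : is_derive x v (fun y : 'rV[R]_n.+1 => y 0 k) (v 0 k).
Proof.
have dl : derivable (fun y : 'rV[R]_n.+1 => y) x v by exact: derivable_id.
have dk := (derivable_mxP (fun y : 'rV[R]_n.+1 => y) x v).1 dl 0 k.
apply: DeriveDef; first exact: dk.
by have := derive_mx dl; rewrite derive_id => /rowP/(_ k); rewrite mxE => ->.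
Qed.

Lemma Ck_coord r O k : Ck r O (fun x => x 0 k).
Proof.
case: r => [|r]; (split; first by move=> x _; exact: coord_continuous) => // i.
split=> [x _|]; first by have [] := is_derive_coord k x (unit_vec i).
rewrite (_ : 'D__ _ = fun=> @unit_vec R n i 0 k); first exact: Ck_cst.
by apply/funext => x; have [] := is_derive_coord k x (unit_vec i).
Qed.

Lemma continuous_row (phi : 'I_n.+1 -> 'rV[R]_n.+1 -> R) x :
  (forall k, {for x, continuous (phi k)}) ->
  {for x, continuous (fun y => \row_k phi k y)}.
Proof.
move=> phic; apply: ((@cvgrPdist_le _ _ _ (nbhs x) _ _ _).2) => e e0; near=> y.
apply: norm_le_coord => [|k]; first exact: ltW.
rewrite !mxE; move: k; near: y.
apply: (@filter_forall _ _ _ (nbhs x)) => k.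
exact: ((@cvgrPdist_le _ _ _ (nbhs x) _ _ _).1 (phic k)).
Unshelve. all: by end_near. Qed.

(** By induction on [r]: the chain rule expresses the first partial derivatives of
    the composite by products of functions of class C^(r-1). *)
Lemma Ck_comp r O O' g (phi : 'I_n.+1 -> 'rV[R]_n.+1 -> R) :
  open O -> open O' -> Ck r O' g -> (forall k, Ck r O (phi k)) ->
  (forall x, O x -> O' (\row_k phi k x)) ->
  Ck r O (fun x => g (\row_k phi k x)).
Proof.
move=> oO oO' + + OO'; elim: r g => [|r IHr] g gC phiC;
  have cont x : O x -> {for x, continuous (fun x => g (\row_k phi k x))} by
    (move=> Ox; apply: (@continuous_comp _ _ _ (fun x => \row_k phi k x) g);
      [by apply: continuous_row => k; exact: (phiC k).1
      |exact: gC.1 (OO' _ Ox)]).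
  by split.
split=> // i.
have key x (Ox : O x) := derive_comp (Ck_differentiable oO' gC (OO' _ Ox))
  (fun k => ((phiC k).2 i).1 x Ox).
split=> [x Ox|]; first exact: (key x Ox).1.
apply: (@Ck_eq r O (fun x => \sum_k 'D_(unit_vec i) (phi k) x *
    ('D_(unit_vec k) g) (\row_k phi k x))) => // [x Ox|].
  exact/esym/(key x Ox).2.
apply: Ck_sum => // k; apply: CkM => //; first exact: ((phiC k).2 i).2.
apply: (IHr ('D_(unit_vec k) g)); first exact: (gC.2 k).2.
by move=> l; exact/Ck_pred/phiC.
Qed.

End Smoothness.

(** * A flat function *)

Section Flat.
Variable R : realType.
Implicit Types (m : nat) (t : R).

(** [flat m t = t^(-m) exp(-1/t)] for [t > 0], and [0] otherwise.  The family is
    closed under differentiation up to linear combinations. *)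
Definition flat m t : R := if 0 < t then t^-1 ^+ m * expR (- t^-1) else 0.

Lemma flatS m t : flat m.+1 t = t^-1 * flat m t.
Proof. by rewrite /flat; case: ifP => _; rewrite ?mulr0// exprS mulrA. Qed.

Lemma flat_ge0 m t : 0 <= flat m t.
Proof.
rewrite /flat; case: ifP => // t0.
by rewrite mulr_ge0 ?expR_ge0// exprn_ge0// invr_ge0 ltW.
Qed.

(** From [u ^ (m + 1) / (m + 1)! <= exp u] at [u = 1/t]; this makes the difference
    quotients of [flat m] at [0], which are the values of [flat m.+1], tend to [0]. *)
Lemma flat_le m t : flat m t <= (m.+1)`!%:R * `|t|.
Proof.
rewrite /flat; case: ifP => t0; last by rewrite mulr_ge0.
have u0 : 0 < t^-1 by rewrite invr_gt0.
have f0 : (0 : R) < (m.+1)`!%:R by rewrite ltr0n fact_gt0.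
rewrite expRN ler_pdivrMr ?expR_gt0// gtr0_norm//.
have : t^-1 ^+ m.+1 / (m.+1)`!%:R <= expR t^-1.
  by apply: le_trans (expR_ge1Dxn m (ltW u0)); rewrite lerDr.
rewrite ler_pdivrMr// => h.
have : t * t^-1 ^+ m.+1 <= t * (expR t^-1 * (m.+1)`!%:R) by rewrite ler_pM2l.
rewrite exprS mulVKf ?gt_eqF// => /le_trans; apply.
by rewrite le_eqVlt; apply/orP; left; apply/eqP; ring.
Qed.

Lemma flat_derive m t :
  is_derive t (1 : R) (flat m) (flat m.+2 t - m%:R * flat m.+1 t).
Proof.
have [t0|t0|->] := ltgtP t 0.
- have -> : flat m.+2 t - m%:R * flat m.+1 t = 0.
    by rewrite /flat ltNge ltW//= mulr0 subr0.
  apply: (@near_eq_is_derive _ _ _ (fun=> 0)) => //.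
  near=> s; rewrite /flat ltNge ltW//=; near: s; exact: lt_nbhsl.
- elim: m => [|m IHm].
    rewrite mul0r subr0.
    apply: (@near_eq_is_derive _ _ _ (fun s : R => expR (- s^-1) : R)) => //.
        near=> s; rewrite /flat expr0 mul1r ifT//; near: s; exact: lt_nbhsr.
    have tn0 : t != 0 by rewrite gt_eqF.
    have dV : is_derive t (1 : R) (fun s : R => s^-1) (- t ^- 2 *: 1).
      exact: (@is_deriveV _ id).
    have dN : is_derive t (1 : R) (fun s : R => - s^-1) (- (- t ^- 2 *: 1)).
      exact: is_deriveN dV.
    have dc := @is_derive1_comp R expR (fun s => - s^-1) t _ _ (is_derive_expR (- t^-1)) dN.
    rewrite (_ : flat 2 t = expR (- t^-1) * - (- t ^- 2 *: 1)); first exact: dc.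
    by rewrite /flat t0 [_ *: 1]mulr1 opprK exprVn mulrC.
  have -> : flat m.+1 = (fun s => s^-1 * flat m s) by apply/funext => s; exact: flatS.
  have tn0 : t != 0 by rewrite gt_eqF.
  have dV : is_derive t (1 : R) (fun s : R => s^-1) (- t ^- 2 *: 1).
    exact: (@is_deriveV _ id).
  apply: (is_derive_eq (is_deriveM dV IHm)).
  rewrite !flatS -natr1 /GRing.scale /=; field; exact: tn0.
- have flat0 k : flat k 0 = 0 by rewrite /flat ltxx.
    rewrite !flat0 mulr0 subr0.
  suff dq : h^-1 *: (flat m (h *: 1 + 0) - flat m 0) @[h --> 0^'] --> (0 : R).
    by apply: DeriveDef; [exact: cvgP dq | exact: cvg_lim].
  have -> : (fun h : R => h^-1 *: (flat m (h *: 1 + 0) - flat m 0)) = flat m.+1.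
    by apply/funext => h; rewrite flat0 subr0 addr0 [h *: 1]mulr1 flatS.
  apply/cvgr0Pnorm_le => e e0; near=> h.
  rewrite ger0_norm ?flat_ge0//; apply: le_trans (flat_le _ _) _.
  have f0 : (0 : R) < (m.+2)`!%:R by rewrite ltr0n fact_gt0.
  rewrite mulrC -ler_pdivlMr//; near: h; apply: dnbhs0_le.
  by rewrite divr_gt0.
Unshelve. all: by end_near. Qed.

End Flat.

(** * Smooth functions on subsets of the half space *)

Section SmoothOn.
Variables (R : realType) (n : nat).
Implicit Types (f g : 'rV[R]_n.+1 -> R) (x : 'rV[R]_n.+1) (O A B : set 'rV[R]_n.+1).

Lemma Ck_flat r O f m : open O -> Ck r O f -> Ck r O (fun x => flat m (f x)).
Proof.
move=> oO; elim: r m => [|r IHr] m fC;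
  (split; first by move=> x Ox; apply: (@continuous_comp _ _ _ f (flat m));
    [exact: Ck_continuous fC Ox | apply: differentiable_continuous;
     apply: (iffLR (derivable1_diffP _ _));
     exact: (@ex_derive _ _ _ _ _ _ _ (flat_derive _ _))]) => // i.
have key x (Ox : O x) := is_derive_comp1 (flat_derive m (f x)) ((fC.2 i).1 x Ox).
split=> [x Ox|]; first by have [] := key x Ox.
have /IHr IH := Ck_pred fC.
apply: (@Ck_eq _ _ r O (fun x => (flat m.+2 (f x) + - m%:R * flat m.+1 (f x)) *
    'D_(unit_vec i) f x)) => // [x Ox|].
  by have [_ E] := key x Ox; rewrite mulNr; exact: esym.
apply: CkM => //; last exact: (fC.2 i).2.
by apply: CkD => //; apply: CkM => //; exact: Ck_cst.
Qed.

Lemma smooth_on_subset A B f : B `<=` A -> smooth_on A f -> smooth_on B f.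
Proof.
move=> BA fs x /BA /fs [ O [g [ oO Ox gs gf]]]; exists O, g; split=> // y Oy /BA.
exact: gf.
Qed.

Lemma smooth_on_eq A f g : (forall x, A x -> f x = g x) ->
  smooth_on A f -> smooth_on A g.
Proof.
move=> fg fs x /fs [ O [h [ oO Ox hs hf]]]; exists O, h; split=> // y Oy Ay.
by rewrite hf// fg.
Qed.

Lemma smooth_on_local A f :
  (forall x, A x -> exists2 O, open O /\ O x & smooth_on (A `&` O) f) ->
  smooth_on A f.
Proof.
move=> fs x Ax; have [ O [ oO Ox] /(_ x (conj Ax Ox))] := fs x Ax.
case=> O' [g [ oO' O'x gs gf]]; exists (O' `&` O), g; split=> //.
- exact: openI.
- by move=> s y [ O'y _]; exact: gs.
- by move=> y [ O'y Oy] Ay; exact: gf.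
Qed.

Lemma smooth_on_global A f : (forall r, Ck r setT f) -> smooth_on A f.
Proof.
move=> /smooth_openP fs x _; exists setT, f; split=> //; exact: openT.
Qed.

Lemma smooth_on_cst A (c : R) : smooth_on A (fun=> c).
Proof. by apply: smooth_on_global => r; exact: Ck_cst. Qed.

Lemma smooth_on_coord A k : smooth_on A (fun x => x 0 k).
Proof. by apply: smooth_on_global => r; exact: Ck_coord. Qed.

Lemma smooth_onD A f g : smooth_on A f -> smooth_on A g ->
  smooth_on A (fun x => f x + g x).
Proof.
move=> fs gs x Ax; have [ O [f' [ oO Ox /smooth_openP f's ff']]] := fs x Ax.
have [ O' [g' [ oO' O'x /smooth_openP g's gg']]] := gs x Ax.
exists (O `&` O'), (fun x => f' x + g' x); split=> //; first exact: openI.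
  apply/smooth_openP => r; apply: CkD; first exact: openI.
    by apply: Ck_subset (f's r) => y [].
  by apply: Ck_subset (g's r) => y [].
by move=> y [ Oy O'y] Ay; rewrite ff'// gg'.
Qed.

Lemma smooth_onM A f g : smooth_on A f -> smooth_on A g ->
  smooth_on A (fun x => f x * g x).
Proof.
move=> fs gs x Ax; have [ O [f' [ oO Ox /smooth_openP f's ff']]] := fs x Ax.
have [ O' [g' [ oO' O'x /smooth_openP g's gg']]] := gs x Ax.
exists (O `&` O'), (fun x => f' x * g' x); split=> //; first exact: openI.
  apply/smooth_openP => r; apply: CkM; first exact: openI.
    by apply: Ck_subset (f's r) => y [].
  by apply: Ck_subset (g's r) => y [].
by move=> y [ Oy O'y] Ay; rewrite ff'// gg'.
Qed.

Lemma smooth_on_sum A (I : Type) (s : seq I) (F : I -> 'rV[R]_n.+1 -> R) :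
  (forall i, smooth_on A (F i)) -> smooth_on A (fun x => \sum_(i <- s) F i x).
Proof.
move=> Fs; elim: s => [|i s IHs].
  by apply: (smooth_on_eq _ (@smooth_on_cst A 0)) => x _; rewrite big_nil.
by apply: (smooth_on_eq _ (smooth_onD (Fs i) IHs)) => x _; rewrite big_cons.
Qed.

(** Simultaneous smooth extension of finitely many functions to a common open
    set, which may be taken inside the preimage of a given open set. *)
Lemma smooth_on_row A (phi : 'I_n.+1 -> 'rV[R]_n.+1 -> R) x O' :
  (forall k, smooth_on A (phi k)) -> A x -> open O' -> O' (\row_k phi k x) ->
  exists O psi, [/\ open O, O x, forall k r, Ck r O (psi k),
    forall y, O y -> O' (\row_k psi k y) &
    forall k y, O y -> A y -> psi k y = phi k y].
Proof.
move=> phis Ax oO' O'x.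
pose Q k (p : set 'rV[R]_n.+1 * ('rV[R]_n.+1 -> R)) :=
  [/\ open p.1, p.1 x, smooth_open p.1 p.2 & forall y, p.1 y -> A y -> p.2 y = phi k y].
have /choice[p pQ] : forall k, exists p, Q k p.
  by move=> k; have [ O [g Og]] := phis k x Ax; exists (O, g).
pose psi k := (p k).2.
pose O1 := [set y | forall k, (p k).1 y].
have nO1 : nbhs x O1.
  apply: (@filter_forall _ _ _ (nbhs x)) => k.
  by apply: open_nbhs_nbhs; have [] := pQ k.
have O1x : O1 x by exact: nbhs_singleton.
have psiC k r : Ck r O1 (psi k).
  have [_ _ /smooth_openP ps _] := pQ k.
  by apply: Ck_subset (ps r) => y /(_ k).
have psiE k y : O1 y -> A y -> psi k y = phi k y.
  by move=> O1y Ay; have [_ _ _ pE] := pQ k; exact: pE (O1y k) Ay.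
pose O := interior (O1 `&` [set y | O' (\row_k psi k y)]).
have OO1 : O `<=` O1 by move=> y /interior_subset[].
exists O, psi; split=> //.
- exact: open_interior.
- apply: (@filterI _ (nbhs x)) => //.
  have cpsi : {for x, continuous (fun y => \row_k psi k y)}.
    by apply: continuous_row => k; exact: Ck_continuous (psiC k 0%N) O1x.
  apply: cpsi; apply: open_nbhs_nbhs; split=> //.
  by rewrite (_ : \row_k _ = \row_k phi k x)//; apply/rowP => k; rewrite !mxE psiE.
- by move=> k r; exact: Ck_subset (psiC k r).
- by move=> y /interior_subset[].
- by move=> k y /OO1 O1y; exact: psiE.
Qed.

Lemma smooth_on_comp A B g (phi : 'I_n.+1 -> 'rV[R]_n.+1 -> R) :
  smooth_on B g -> (forall k, smooth_on A (phi k)) ->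
  (forall x, A x -> B (\row_k phi k x)) ->
  smooth_on A (fun x => g (\row_k phi k x)).
Proof.
move=> gs phis AB x Ax.
have [ O' [g' [ oO' O'x /smooth_openP g's gg']]] := gs _ (AB x Ax).
have [ O [psi [ oO Ox psiC psiO' psiE]]] := smooth_on_row phis Ax oO' O'x.
exists O, (fun y => g' (\row_k psi k y)); split=> //.
  by apply/smooth_openP => r; apply: (Ck_comp oO oO').
move=> y Oy Ay; have E : \row_k psi k y = \row_k phi k y.
  by apply/rowP => k; rewrite !mxE psiE.
by rewrite gg'//; [rewrite E | exact: psiO' | rewrite E; exact: AB].
Qed.

(** [A] is a relatively open subset of the half space. *)
Definition half_open A : Prop :=
  A `<=` half_space /\
  forall x, A x -> \forall y \near x, half_space y -> A y.

(** A partial derivative relative to the half space can be computed on any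
    extension across the boundary; the filter of admissible increments is proper
    because it contains the small positive ones. *)
Lemma half_partialE i f g x : half_space x ->
  (\forall y \near x, half_space y -> g y = f y) ->
  derivable g x (unit_vec i) -> half_partial i f x = 'D_(unit_vec i) g x.
Proof.
move=> Hx gf dg; rewrite /half_partial.
set F := within _ _.
have FF : ProperFilter F.
  apply: Build_ProperFilter_ex => P /= FP.
  have [e /= e0 eP] : nbhs 0^' [set h : R | half_space (h *: unit_vec i + x) -> P h] by [].
  exists (e / 2); apply: eP.
  - by rewrite /ball /= sub0r normrN gtr0_norm ?divr_gt0// ltr_pdivrMr// ltr_pMr// ltr1n.
  - by rewrite gt_eqF// divr_gt0.
  - rewrite /half_space /= 2!mxE unit_vecE addr_ge0//.
    by rewrite mulr_ge0// divr_ge0// ltW.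
apply: cvg_lim => //.
have qg : (fun h : R => h^-1 *: ((g \o shift x) (h *: unit_vec i) - g x)) @ F -->
    'D_(unit_vec i) g x.
  by apply: cvg_trans dg; apply: cvg_app; exact: cvg_within.
apply: cvg_trans qg; apply: (@near_eq_cvg _ _ F).
have line : (fun h : R => h *: @unit_vec R n i + x) @ 0^' --> x.
  have c : continuous (fun h : R => h *: @unit_vec R n i + x).
    by move=> h; exact: (@continuousD R 'rV[R]_n.+1 R (fun h => h *: unit_vec i)
      (fun=> x) h (@scalel_continuous _ _ _ h) (@cst_continuous _ _ _ h)).
  have := c 0; rewrite /continuous_at scale0r add0r => c0.
  by apply: cvg_trans c0; apply: cvg_app; exact: nbhs_dnbhs.
have lgf : \forall h \near 0^', half_space (h *: unit_vec i + x) ->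
    g (h *: unit_vec i + x) = f (h *: unit_vec i + x).
  exact: (line _ gf).
rewrite /F /prop_near1 /within /=; apply: filterS lgf => h gfh Hh /=.
by rewrite gfh// (nbhs_singleton gf Hx).
Qed.

Lemma half_partial_smooth A f i : half_open A -> smooth_on A f ->
  smooth_on A (half_partial i f).
Proof.
move=> [AH Ao] fs x Ax; have [ O [g [ oO Ox gs gf]]] := fs x Ax.
have /smooth_openP gC := gs.
exists O, ('D_(unit_vec i) g); split; [exact: oO | exact: Ox | | ].
  by apply/smooth_openP => r; exact: ((gC r.+1).2 i).2.
move=> y Oy Ay; apply/esym; apply: half_partialE; first exact: AH.
  by near=> z => Hz; apply: gf; [near: z; exact: open_nbhs_nbhs | move: Hz; near: z; exact: Ao].
exact: ((gC 1%N).2 i).1.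
Unshelve. all: by end_near. Qed.

Lemma half_partial_eq A f g i x : half_open A -> A x ->
  smooth_on A f -> (forall y, A y -> f y = g y) ->
  half_partial i f x = half_partial i g x.
Proof.
move=> [AH Ao] Ax fs fg; have [W [h [openW Wx hs hf]]] := fs x Ax.
have nA : \forall y \near x, half_space y -> A y by exact: Ao.
have nW : \forall y \near x, W y by exact: open_nbhs_nbhs.
have dh : derivable h x (unit_vec i) by exact: (hs [::] x Wx).2.
rewrite (half_partialE (AH _ Ax) _ dh); last first.
  by near=> y => Hy; apply: hf; [near: y | move: Hy; near: y].
rewrite (half_partialE (AH _ Ax) _ dh)//.
by near=> y => Hy; have Ay : A y by [move: Hy; near: y]; rewrite -fg ?hf//; near: y.
Unshelve. all: by end_near. Qed.

Lemma half_partial_coord i k x : half_space x ->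
  half_partial i (fun y : 'rV[R]_n.+1 => y 0 k) x = (k == i)%:R.
Proof.
move=> Hx; have [d dE] := is_derive_coord k x (@unit_vec R n i).
rewrite (@half_partialE i _ (fun y => y 0 k))// ?dE ?unit_vecE//.
by apply: (@filterE _ (nbhs x)).
Qed.

(** The chain rule, up to the boundary of the half space. *)
Lemma half_partial_comp A B g (phi : 'I_n.+1 -> 'rV[R]_n.+1 -> R) i x :
  half_open A -> half_open B -> smooth_on B g -> (forall k, smooth_on A (phi k)) ->
  (forall y, A y -> B (\row_k phi k y)) -> A x ->
  half_partial i (fun y => g (\row_k phi k y)) x =
  \sum_k half_partial i (phi k) x * half_partial k g (\row_k phi k x).
Proof.
move=> [AH Ao] [BH Bo] gs phis AB Ax.
have [ O' [g' [ oO' O'x /smooth_openP g's gg']]] := gs _ (AB x Ax).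
have [ O [psi [ oO Ox psiC psiO' psiE]]] := smooth_on_row phis Ax oO' O'x.
have nA : \forall y \near x, half_space y -> A y by exact: Ao.
have nO : \forall y \near x, O y by exact: open_nbhs_nbhs.
have E y : O y -> A y -> \row_k psi k y = \row_k phi k y.
  by move=> Oy Ay; apply/rowP => k; rewrite !mxE psiE.
have [d dE] := derive_comp (Ck_differentiable oO' (g's 1%N) (psiO' _ Ox))
  (fun k => ((psiC k 1%N).2 i).1 x Ox).
rewrite (@half_partialE i _ _ x _ _ d); first last.
- near=> y => Hy /=; have Ay : A y by move: Hy; near: y.
  have Oy : O y by near: y.
  by rewrite gg' ?E//; [rewrite -E//; exact: psiO' | exact: AB].
- exact: AH.
rewrite dE; apply: eq_bigr => k _; congr (_ * _).
  apply/esym/half_partialE; first exact: AH.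
    by near=> y => Hy; apply: psiE; [near: y | move: Hy; near: y].
  exact: ((psiC k 1%N).2 i).1.
rewrite E//; apply/esym/half_partialE; first exact/BH/AB.
  by near=> y => Hy; apply: gg'; [near: y; exact: open_nbhs_nbhs | move: Hy; near: y; exact/Bo/AB].
have [_ /(_ k)[dg' _]] := g's 1%N.
by have := dg' _ (psiO' _ Ox); rewrite (E _ Ox Ax).
Unshelve. all: by end_near. Qed.

End SmoothOn.

(** * Functions in charts *)

Section Charts.
Variables (R : realType) (n : nat) (T : topologicalType).
Implicit Types (c : chart R n T) (p : T) (W V : set T) (f g : T -> R).

(** Charts are open maps into the half space. *)
Lemma chart_image_half_open c W : open W -> half_open (c @` (dom c `&` W)).
Proof.
move=> oW; have [U oU cU] := coord_image_open c; split=> [_ [p [cp _] <-]|_ [p [cp Wp] <-]].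
  suff : (U `&` half_space) (c p) by case.
  by rewrite -cU; exists p.
have Ip : (c @` dom c) (c p) by exists p.
have Up : U (c p) by have := Ip; rewrite cU => -[].
have cI : coord_inv c @ within (c @` dom c) (nbhs (c p)) --> coord_inv c (c p).
  have /subspace_continuousP := @coord_inv_continuous _ _ _ c; exact.
rewrite coord_invK// in cI; have nW := cI W (open_nbhs_nbhs (conj oW Wp)).
have nU : \forall y \near c p, U y by exact: open_nbhs_nbhs.
near=> y => Hy.
have : (c @` dom c) y by rewrite cU; split=> //; near: y.
move=> [q cq qy]; exists q => //; split=> //.
have : W (coord_inv c y).
  have : (c @` dom c) y by exists q.
  by near: y.
by rewrite -qy coord_invK.
Unshelve. all: by end_near. Qed.

Lemma chart_preimage_open c (O : set 'rV[R]_n.+1) : open O -> open (dom c `&` c @^-1` O).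
Proof.
move=> oO; rewrite openE => p [cp Op].
have cc : c @ within (dom c) (nbhs p) --> c p.
  have /subspace_continuousP := @Defs.coord_continuous _ _ _ c; exact.
have nO := cc O (open_nbhs_nbhs (conj oO Op)).
have nd : \forall q \near p, dom c q.
  by apply: open_nbhs_nbhs; split=> //; exact: dom_open.
have : \forall q \near p, dom c q /\ (dom c q -> O (c q)) by apply: filterI.
by apply: filterS => q [cq /(_ cq)].
Qed.

Lemma smooth_in_chart_eq c W f g : (forall p, dom c p -> W p -> f p = g p) ->
  smooth_in_chart c W f -> smooth_in_chart c W g.
Proof.
move=> fg; apply: smooth_on_eq => _ [p [cp Wp] <-] /=.
by rewrite coord_invK// fg.
Qed.

Lemma smooth_in_chart_subset c W V f : (forall p, dom c p -> V p -> W p) ->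
  smooth_in_chart c W f -> smooth_in_chart c V f.
Proof.
move=> VW; apply: smooth_on_subset => _ [p [cp Vp] <-]; exists p => //.
by split=> //; exact: VW.
Qed.

Lemma smooth_in_chart_cst c W (a : R) : smooth_in_chart c W (fun=> a).
Proof. exact: smooth_on_cst. Qed.

Lemma smooth_in_chartD c W f g : smooth_in_chart c W f -> smooth_in_chart c W g ->
  smooth_in_chart c W (fun p => f p + g p).
Proof. exact: smooth_onD. Qed.

Lemma smooth_in_chartM c W f g : smooth_in_chart c W f -> smooth_in_chart c W g ->
  smooth_in_chart c W (fun p => f p * g p).
Proof. exact: smooth_onM. Qed.

Lemma smooth_in_chart_sum c W (I : Type) (s : seq I) (F : I -> T -> R) :
  (forall i, smooth_in_chart c W (F i)) ->
  smooth_in_chart c W (fun p => \sum_(i <- s) F i p).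
Proof. exact: (@smooth_on_sum R n _ I s (fun i => F i \o coord_inv c)). Qed.

Lemma smooth_in_chart_local c W f :
  (forall p, dom c p -> W p -> exists2 V, open V /\ V p & smooth_in_chart c (W `&` V) f) ->
  smooth_in_chart c W f.
Proof.
move=> fs; apply: smooth_on_local => _ [p [cp Wp] <-].
have [V [oV Vp] fV] := fs p cp Wp.
have [VH Vo] := chart_image_half_open c oV.
have nV : \forall y \near c p, half_space y -> (c @` (dom c `&` V)) y.
  by apply: Vo; exists p.
exists (interior [set y | half_space y -> (c @` (dom c `&` V)) y]).
  by split; [exact: open_interior | exact: nV].
apply: smooth_on_subset fV => _ [[q [cq Wq] <-] /interior_subset /= qV].
exists q => //; split=> //; split=> //.
have [|r [cr Vr] rq] := qV.
  by have [+ _] := chart_image_half_open c openT; apply; exists q.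
by rewrite -(coord_invK cq) -rq coord_invK.
Qed.

End Charts.

Section ManifoldCharts.
Variables (R : realType) (n : nat) (M : manifold R n).
Local Notation chartM := (chart R n M).
Implicit Types (c : chartM) (p : M) (W V : set M) (f g : M -> R) (xi eta : field M).

Lemma smooth_in_chart_partial c W f i : open W -> smooth_in_chart c W f ->
  smooth_in_chart c W (partial c i f).
Proof.
move=> oW fs; have := half_partial_smooth i (chart_image_half_open c oW) fs.
by apply: smooth_on_eq => _ [p [cp Wp] <-] /=; rewrite /partial coord_invK.
Qed.

Lemma partial_coord c i k p : dom c p ->
  partial c i (fun q => c q 0 k) p = (k == i)%:R.
Proof.
move=> cp; have hA := chart_image_half_open c openT.
have Ap : (c @` (dom c `&` setT)) (c p) by exists p.
rewrite /partial -(half_partial_coord i k (hA.1 _ Ap)); apply/esym.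
apply: (half_partial_eq i hA Ap (@smooth_on_coord R n _ k)).
by move=> _ [q [cq _] <-] /=; rewrite coord_invK.
Qed.

(** The transition map from [c'] to [c], reassembled from its coordinate functions. *)
Lemma row_chart c c' q : dom c q -> dom c' q ->
  \row_k ((fun p => c p 0 k) \o coord_inv c') (c' q) = c q.
Proof. by move=> cq c'q; apply/rowP => k; rewrite mxE /= coord_invK. Qed.

Lemma smooth_in_chart_change c c' W f : atlas c -> atlas c' ->
  smooth_in_chart c W f -> smooth_in_chart c' (dom c `&` W) f.
Proof.
move=> ac ac' fs.
have phis k : smooth_on (c' @` (dom c' `&` (dom c `&` W)))
    ((fun p => c p 0 k) \o coord_inv c').
  apply: smooth_on_subset (atlas_compatible ac' ac k) => _ [q [c'q [cq _]] <-].
  by exists q.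
have AB x : (c' @` (dom c' `&` (dom c `&` W))) x ->
    (c @` (dom c `&` W)) (\row_k ((fun p => c p 0 k) \o coord_inv c') x).
  by move=> [q [c'q [cq Wq]] <-]; rewrite row_chart//; exists q.
apply: smooth_on_eq (smooth_on_comp fs phis AB) => _ [q [c'q [cq Wq]] <-].
by rewrite row_chart//= !coord_invK.
Qed.

Lemma smooth_fun_of_chart c W f : atlas c -> W `<=` dom c ->
  smooth_in_chart c W f -> smooth_fun W f.
Proof.
move=> ac Wc fs c' ac'; apply: smooth_in_chart_subset (smooth_in_chart_change ac ac' fs).
by move=> p _ Wp; split=> //; exact: Wc.
Qed.

(** The chain rule for a change of charts. *)
Lemma partial_chain c c' W i f p : atlas c -> atlas c' -> open W ->
  smooth_in_chart c' W f -> dom c p -> dom c' p -> W p ->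
  partial c i f p = \sum_k partial c i (fun q => c' q 0 k) p * partial c' k f p.
Proof.
move=> ac ac' oW fs cp c'p Wp.
pose V := dom c' `&` W.
have oV : open V by apply: openI => //; exact: dom_open.
have hA := chart_image_half_open c oV; have hB := chart_image_half_open c' oW.
have Ap : (c @` (dom c `&` V)) (c p) by exists p.
have phis k : smooth_on (c @` (dom c `&` V)) ((fun q => c' q 0 k) \o coord_inv c).
  apply: smooth_on_subset (atlas_compatible ac ac' k) => _ [q [cq [c'q _]] <-].
  by exists q.
have AB x : (c @` (dom c `&` V)) x ->
    (c' @` (dom c' `&` W)) (\row_k ((fun q => c' q 0 k) \o coord_inv c) x).
  by move=> [q [cq [c'q Wq]] <-]; rewrite row_chart//; exists q.
rewrite {1}/partial -(half_partial_eq i hA Ap (smooth_on_comp fs phis AB)); last first.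
  by move=> _ [q [cq [c'q Wq]] <-]; rewrite row_chart//= !coord_invK.
rewrite (half_partial_comp i hA hB fs phis AB Ap) row_chart//.
Qed.

Lemma smooth_in_chart_transition c c' k : atlas c -> atlas c' ->
  smooth_in_chart c (dom c') (fun q => c' q 0 k).
Proof. by move=> ac ac'; exact: atlas_compatible. Qed.

(** * Vector fields *)

Lemma vector_field_subset W V xi : V `<=` W -> vector_field W xi -> vector_field V xi.
Proof.
move=> VW [xis xit]; split=> [c ac i|c c' p ac ac' cp c'p Vp k].
  by apply: smooth_in_chart_subset (xis c ac i) => p _ /VW.
by apply: xit => //; exact: VW.
Qed.

Lemma vector_field_eq W xi eta : field_eq W xi eta -> vector_field W xi ->
  vector_field W eta.
Proof.
move=> E [xis xit]; split=> [c ac i|c c' p ac ac' cp c'p Wp k].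
  by apply: smooth_in_chart_eq (xis c ac i) => p cp Wp; rewrite E.
rewrite -E// (xit c c' p)//; by apply: eq_bigr => i _; rewrite E.
Qed.

Lemma vector_field_local W xi :
  (forall p, W p -> exists2 V, open V /\ V p & vector_field (W `&` V) xi) ->
  vector_field W xi.
Proof.
move=> Wxi; split=> [c ac i|c c' p ac ac' cp c'p Wp k].
  apply: smooth_in_chart_local => p cp Wp; have [V oV [xis _]] := Wxi p Wp.
  by exists V => //; exact: xis.
by have [V [_ Vp] [_ xit]] := Wxi p Wp; exact: xit.
Qed.

Lemma vector_field0 W : vector_field W (fun _ _ => 0).
Proof.
split=> [c ac i|c c' p ac ac' cp c'p Wp k].
  by apply: smooth_in_chart_eq (@smooth_in_chart_cst _ _ _ c W 0) => p _ _; rewrite mxE.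
by rewrite mxE big1// => i _; rewrite mxE mul0r.
Qed.

Lemma vector_fieldD W xi eta : vector_field W xi -> vector_field W eta ->
  vector_field W (field_add xi eta).
Proof.
move=> [xis xit] [etas etat]; split=> [c ac i|c c' p ac ac' cp c'p Wp k].
  apply: smooth_in_chart_eq (smooth_in_chartD (xis c ac i) (etas c ac i)) => p _ _.
  by rewrite mxE.
rewrite mxE (xit c)// (etat c)// -big_split; apply: eq_bigr => i _ /=.
by rewrite mxE mulrDl.
Qed.

Lemma vector_fieldZ W f xi : smooth_fun W f -> vector_field W xi ->
  vector_field W (field_scale f xi).
Proof.
move=> fs [xis xit]; split=> [c ac i|c c' p ac ac' cp c'p Wp k].
  apply: smooth_in_chart_eq (smooth_in_chartM (fs c ac) (xis c ac i)) => p _ _.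
  by rewrite mxE.
by rewrite mxE (xit c)// mulr_sumr; apply: eq_bigr => i _; rewrite mxE mulrA.
Qed.

(** The pointwise sum of the fields [F i], for [i] in [s]. *)
Definition field_sum (s : seq 'I_n.+1) (F : 'I_n.+1 -> field M) : field M :=
  fun c p => \sum_(i <- s) F i c p.

Lemma field_sum_nil F : field_sum [::] F = fun _ _ => 0.
Proof. by apply/funext => c; apply/funext => p; rewrite /field_sum big_nil. Qed.

Lemma field_sum_cons i s F : field_sum (i :: s) F = field_add (F i) (field_sum s F).
Proof. by apply/funext => c; apply/funext => p; rewrite /field_sum big_cons. Qed.

Lemma vector_field_sum W s F : (forall i, vector_field W (F i)) ->
  vector_field W (field_sum s F).
Proof.
move=> FW; elim: s => [|i s IHs]; first by rewrite field_sum_nil; exact: vector_field0.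
by rewrite field_sum_cons; exact: vector_fieldD.
Qed.

(** The transformation law of a coordinate field is the chain rule. *)
Lemma vector_field_coord c i : atlas c -> vector_field (dom c) (coord_field c i).
Proof.
move=> ac; split=> [c' ac' k|c1 c2 p ac1 ac2 c1p c2p cp k].
  have := smooth_in_chart_partial i (dom_open c') (smooth_in_chart_transition k ac ac').
  move=> /(smooth_in_chart_change ac ac') s.
  by apply: (smooth_in_chart_eq _ (smooth_in_chart_subset _ s)) => p c'p cp //; rewrite mxE.
rewrite mxE (partial_chain i ac ac1 (dom_open c2) (smooth_in_chart_transition k ac1 ac2))//.
by apply: eq_bigr => l _; rewrite mxE.
Qed.

Lemma coord_fieldE c i p : dom c p -> coord_field c i c p = unit_vec i.
Proof.
by move=> cp; apply/rowP => k; rewrite mxE partial_coord// unit_vecE.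
Qed.

(** A vector field is the combination of the coordinate fields of a chart whose
    coefficients are its components. *)
Lemma vector_field_expand c W xi : atlas c -> W `<=` dom c -> vector_field W xi ->
  field_eq W (field_sum (index_enum _)
    (fun i => field_scale (fun p => xi c p 0 i) (coord_field c i))) xi.
Proof.
move=> ac Wc [_ xit] c' p ac' c'p Wp; apply/rowP => k.
rewrite (xit c)//; last exact: Wc.
by rewrite summxE; apply: eq_bigr => i _; rewrite !mxE.
Qed.

Lemma smooth_fun_component c W xi i : atlas c -> W `<=` dom c ->
  vector_field W xi -> smooth_fun W (fun p => xi c p 0 i).
Proof. by move=> ac Wc [xis _]; apply: smooth_fun_of_chart Wc _ => //; exact: xis. Qed.

Lemma field_eq_of_chart c W xi eta : atlas c -> W `<=` dom c ->
  vector_field W xi -> vector_field W eta ->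
  (forall p, W p -> xi c p = eta c p) -> field_eq W xi eta.
Proof.
move=> ac Wc [_ xit] [_ etat] E c' p ac' c'p Wp; apply/rowP => k.
have cp := Wc _ Wp; rewrite (xit c)// (etat c)//.
by apply: eq_bigr => i _; rewrite E.
Qed.

Lemma interior_points_open : open (interior_points M).
Proof.
rewrite openE => p [c [ac cp c0]].
have o0 : open [set x : 'rV[R]_n.+1 | 0 < x 0 ord0].
  apply: (@open_comp _ R (fun x : 'rV[R]_n.+1 => x 0 ord0) [set y : R | 0 < y]).
    by move=> x _; exact: coord_continuous.
  exact: open_gt.
have := chart_preimage_open c o0; rewrite openE => /(_ p (conj cp c0)).
by apply: filterS => q [cq c0q]; exists c.
Qed.

(** * Restriction of a chart *)

(** The chart [c] restricted to [dom c `&` V]; the two coordinate maps are kept, so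
    that partial derivatives and coordinate fields are definitionally unchanged. *)
Definition chart_restrict c V (oV : open V) : chartM.
Proof.
refine (@Chart R n M (dom c `&` V) c (coord_inv c) _ _ _ _ _).
- by apply: openI => //; exact: dom_open.
- by move=> p [cp _]; exact: coord_invK.
- have [VH Vo] := chart_image_half_open c oV.
  exists (interior [set y | half_space y -> (c @` (dom c `&` V)) y]).
    exact: open_interior.
  apply/seteqP; split=> [y Ay|y [/interior_subset yA Hy]]; last exact: yA.
  by split; [exact: Vo | exact: VH].
- by apply: continuous_subspaceW (@Defs.coord_continuous _ _ _ c) => p [].
- apply: continuous_subspaceW (@coord_inv_continuous _ _ _ c) => _ [p [cp _] <-].
  by exists p.
Defined.

Lemma chart_restrict_atlas c V (oV : open V) : atlas c -> atlas (chart_restrict c oV).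
Proof.
move=> ac; apply: atlas_maximal => c' ac'; split=> i.
  apply: smooth_on_subset (atlas_compatible ac ac' i) => _ [p [[cp _] c'p] <-].
  by exists p.
apply: smooth_on_subset (atlas_compatible ac' ac i) => _ [p [c'p [cp _]] <-].
by exists p.
Qed.

End ManifoldCharts.

(** * Cutoff functions *)

Section Bump.
Variables (R : realType) (n : nat).

Lemma flat0_le0 (t : R) : t <= 0 -> flat 0 t = 0.
Proof. by rewrite /flat leNgt => /negbTE ->. Qed.

Lemma flat0_gt0 (t : R) : 0 < t -> 0 < flat 0 t.
Proof. by rewrite /flat => ->; rewrite mul1r expR_gt0. Qed.

Lemma flat0_homo (s t : R) : s <= t -> flat 0 s <= flat 0 t.
Proof.
move=> st; have [s0|s0] := leP s 0; first by rewrite flat0_le0// flat_ge0.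
have t0 := lt_le_trans s0 st.
by rewrite /flat s0 t0 !mul1r ler_expR lerN2 lef_pV2.
Qed.

(** A smooth plateau function, equal to [1] near [a] and vanishing outside of a
    ball: with [q] the squared Euclidean distance to [a] and [beta = flat 0],
    take [beta (beta r - beta (q - r)) / beta (beta r)]. *)
Lemma bump (a : 'rV[R]_n.+1) (e : R) : 0 < e ->
  exists f : 'rV[R]_n.+1 -> R,
    [/\ forall r, Ck r setT f, \forall y \near a, f y = 1 &
        forall y, e <= `|y - a| -> f y = 0].
Proof.
move=> e0; pose q (y : 'rV[R]_n.+1) := \sum_k (y 0 k + - a 0 k) * (y 0 k + - a 0 k).
(* [q < r] near [a], while [|y - a| >= e] in the sup norm gives [q y >= e^2 = 2 r]. *)
pose r := e ^+ 2 / 2; have r0 : 0 < r by rewrite divr_gt0// exprn_gt0.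
pose eps := flat 0 r; have eps0 : 0 < eps by exact: flat0_gt0.
have nz : flat 0 eps != 0 by rewrite gt_eqF// flat0_gt0.
pose f y := (flat 0 eps)^-1 * flat 0 (eps + -1 * flat 0 (q y + - r)).
have qC m : Ck m setT q.
  apply: Ck_sum => [|k]; first exact: openT.
  have d : Ck m setT (fun y : 'rV[R]_n.+1 => y 0 k + - a 0 k).
    by apply: CkD; [exact: openT | exact: Ck_coord | exact: Ck_cst].
  by apply: CkM => //; exact: openT.
have fC m : Ck m setT f.
  have oT := @openT 'rV[R]_n.+1.
  apply: CkM; [by [] | exact: Ck_cst |]; apply: Ck_flat => //.
  apply: CkD; [by [] | exact: Ck_cst |]; apply: CkM; [by [] | exact: Ck_cst |].
  by apply: Ck_flat => //; apply: CkD; [by [] | exact: qC | exact: Ck_cst].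
exists f; split=> //.
- have qa : q a = 0 by rewrite /q big1// => k _; rewrite subrr mul0r.
  have : \forall y \near a, q y < r.
    have := Ck_continuous (qC 0%N) (I : setT a); rewrite /prop_for /continuous_at qa.
    by move=> /(_ [set t | t < r]); apply; apply: lt_nbhsl.
  apply: filterS => y qy; rewrite /f (@flat0_le0 (q y + - r)) ?subr_le0 ?ltW//.
  by rewrite mulr0 addr0 mulVf.
- move=> y ey; rewrite /f (@flat0_le0 (eps + _)) ?mulr0// mulN1r subr_le0.
  apply: flat0_homo; rewrite lerBrDr /r -splitr.
  have [k ek] : exists k, e <= `|y 0 k - a 0 k|.
    apply: contrapT => /forallNP nk; suff : `|y - a| < e by rewrite ltNge ey.
    rewrite [ltLHS]/Num.Def.normr/= mx_normrE; apply/bigmax_ltP; split=> // -[i k] _ /=.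
    by rewrite ord1 !mxE ltNge; apply/negP; exact: nk.
  rewrite /q (bigD1 k)//=; apply: le_trans (_ : e ^+ 2 <= (y 0 k - a 0 k) * (y 0 k - a 0 k)) _.
    by rewrite -expr2 -[leRHS]real_normK ?num_real// ler_sqr// nnegrE// ltW.
  by rewrite lerDl sumr_ge0// => l _; rewrite -expr2 sqr_ge0.
Qed.

End Bump.

Section Cutoff.
Variables (R : realType) (n : nat) (M : manifold R n).

(** Localisation: cutoff functions turn vector fields on the domain of a chart
    into global ones, without changing them near a given point.  This is where
    the Hausdorff property enters, through the closedness of the support. *)
Lemma cutoff (c : chart R n M) (x : M) : atlas c -> dom c x ->
  exists V (b : M -> R),
    [/\ open V, V x, V `<=` dom c, forall p, V p -> b p = 1 &
        forall xi, vector_field (dom c) xi -> vector_field setT (field_scale b xi)].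
Proof.
move=> ac cx.
have [cH co] := chart_image_half_open c openT.
have Ix : (c @` (dom c `&` setT)) (c x) by exists x.
have /nbhs_ballP[d /= d0 dP] := co _ Ix.
have e0 : 0 < d / 2 by rewrite divr_gt0.
have [f [fC f1 f0]] := bump (c x) e0.
pose b p := if p \in dom c then f (c p) else 0.
have bE p : dom c p -> b p = f (c p) by move=> cp; rewrite /b mem_set.
(* The compact set [K'] lies in the image of [c], so its preimage [K] is closed in
   [M]; the cutoff function [b] vanishes outside of [K]. *)
pose K' := half_space `&` [set y : 'rV[R]_n.+1 | `|y - c x| <= d / 2].
have K'I : K' `<=` c @` dom c.
  move=> y [Hy yx]; have [|p [cp _] <-] := dP y _ Hy; last by exists p.
  rewrite mx_norm_ball /ball_ /= distrC (le_lt_trans yx)//.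
  by rewrite ltr_pdivrMr// ltr_pMr// ltr1n.
have K'c : compact K'.
  apply: bounded_closed_compact.
    exists (`|c x| + d / 2); split; first exact: num_real.
    move=> m lem y [_ /= yx]; apply: le_trans (ltW lem).
    by rewrite -[X in `|X| <= _](subrK (c x)) addrC (le_trans (ler_normD _ _))// lerD2l.
  apply: closedI.
    apply: (@preimage_closed _ R (fun y : 'rV[R]_n.+1 => y 0 ord0) [set t : R | 0 <= t]).
      by move=> y _; exact: coord_continuous.
    exact: closed_ge.
  apply: (@preimage_closed _ R (fun y : 'rV[R]_n.+1 => `|y - c x|) [set t : R | t <= d / 2]).
    move=> y _; apply: (@continuous_comp _ _ _ (fun y : 'rV[R]_n.+1 => y - c x) (fun z => `|z|)).
      by apply: (@continuousB _ _ _ id (cst (c x))) => //; exact: cst_continuous.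
    exact: norm_continuous.
  exact: closed_le.
pose K := coord_inv c @` K'.
have Kc : closed K.
  apply: compact_closed; first exact: space_hausdorff.
  apply: continuous_compact => //.
  exact: continuous_subspaceW K'I (@coord_inv_continuous _ _ _ c).
have KI : K `<=` dom c.
  by move=> _ [y /K'I [p cp <-] <-]; rewrite coord_invK.
have b0 p : ~ K p -> b p = 0.
  rewrite /b; case: ifP => // /set_mem cp nKp; apply: f0.
  rewrite leNgt; apply/negP => yx; apply: nKp; exists (c p); last exact: coord_invK.
  by split; [apply: cH; exists p | exact: ltW].
pose V := dom c `&` c @^-1` (interior [set y | f y = 1]).
exists V, b; split.
- exact/chart_preimage_open/open_interior.
- by split.
- by move=> p [].
- by move=> p [cp /interior_subset f1p]; rewrite bE.
move=> xi xiv; apply: vector_field_local => p _.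
have [cp|ncp] := pselect (dom c p).
  exists (dom c); first by split=> //; exact: dom_open.
  rewrite setTI; apply: vector_fieldZ => //; apply: smooth_fun_of_chart (ac) _ _ => //.
  apply: (smooth_in_chart_eq (f := f \o c)) => [q cq _|]; first by rewrite bE.
  apply: (smooth_on_eq (f := f)); last exact: smooth_on_global.
  by move=> _ [q [cq _] <-] /=; rewrite coord_invK.
exists (~` K); first by split; [exact: closed_openC | move=> /KI].
apply: vector_field_eq (vector_field0 _) => c' q ac' c'q [_ nKq].
by rewrite /field_scale b0// scale0r.
Qed.

End Cutoff.

(** * Linear connections and projective changes *)

Section Connections.
Variables (R : realType) (n : nat) (M : manifold R n) (D : connection M).
Local Notation chartM := (chart R n M).
Local Notation int := (interior_points M).
Implicit Types (c : chartM) (p : M) (W V : set M) (f g : M -> R) (xi eta : field M).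

Lemma field_scale0 : field_scale (fun _ : M => 0 : R) (fun _ _ => 0) = (fun _ _ => 0) :> field M.
Proof. by apply/funext => c; apply/funext => q; rewrite /field_scale scale0r. Qed.

Lemma smooth_fun0 W : smooth_fun W (fun _ : M => 0 : R).
Proof. by move=> c _; exact: smooth_in_chart_cst. Qed.

Lemma conn_suml W s F eta : open W -> W `<=` int ->
  (forall i, vector_field W (F i)) -> vector_field W eta ->
  field_eq W (D (field_sum s F) eta) (field_sum s (fun i => D (F i) eta)).
Proof.
move=> oW Wi Fv etav; elim: s => [|i s IHs] c p ac cp Wp.
  rewrite !field_sum_nil -[X in D X]field_scale0.
  by rewrite (conn_scalel D oW Wi (@smooth_fun0 W) (vector_field0 W) etav ac cp Wp)
    /field_scale scale0r.
rewrite !field_sum_cons (conn_addl D oW Wi (Fv i) (vector_field_sum s Fv) etav ac cp Wp).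
by rewrite /field_add IHs.
Qed.

Lemma conn_sumr W s F xi : open W -> W `<=` int ->
  vector_field W xi -> (forall i, vector_field W (F i)) ->
  field_eq W (D xi (field_sum s F)) (field_sum s (fun i => D xi (F i))).
Proof.
move=> oW Wi xiv Fv; elim: s => [|i s IHs] c p ac cp Wp.
  rewrite !field_sum_nil -[X in D _ X]field_scale0.
  by rewrite (conn_leibniz D oW Wi (@smooth_fun0 W) xiv (vector_field0 W) ac cp Wp)
    scale0r add0r scaler0.
rewrite !field_sum_cons (conn_addr D oW Wi xiv (Fv i) (vector_field_sum s Fv) ac cp Wp).
by rewrite /field_add IHs.
Qed.

Lemma dir_deriv_coord c i f p : dom c p ->
  dir_deriv (coord_field c i) f c p = partial c i f p.
Proof.
move=> cp; rewrite /dir_deriv (bigD1 i)//= big1 => [|k ki].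
  by rewrite coord_fieldE// unit_vecE eqxx mul1r addr0.
by rewrite coord_fieldE// unit_vecE (negbTE ki) mul0r.
Qed.

(** The covariant derivative in terms of the connection coefficients. *)
Lemma conn_in_chart c W xi eta p k : atlas c -> open W -> W `<=` dom c -> W `<=` int ->
  vector_field W xi -> vector_field W eta -> W p ->
  D xi eta c p 0 k = \sum_i xi c p 0 i * (partial c i (fun q => eta c q 0 k) p +
    \sum_j eta c p 0 j * conn_coef D c k i j p).
Proof.
move=> ac oW Wc Wi xiv etav Wp; have cp := Wc _ Wp.
have dv i : vector_field W (coord_field c i).
  exact: vector_field_subset Wc (vector_field_coord i ac).
pose comp zeta i := fun q => (zeta : field M) c q 0 i.
have cs zeta i : vector_field W zeta -> smooth_fun W (comp zeta i).
  exact: smooth_fun_component.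
have sv zeta i : vector_field W zeta ->
    vector_field W (field_scale (comp zeta i) (coord_field c i)).
  by move=> zv; apply: vector_fieldZ => //; exact: cs.
have expand zeta : vector_field W zeta -> field_eq W zeta
    (field_sum (index_enum _) (fun i => field_scale (comp zeta i) (coord_field c i))).
  by move=> zv c' q ac' c'q Wq; rewrite (vector_field_expand ac Wc zv).
rewrite (conn_local D oW Wi xiv (vector_field_sum _ (fun i => sv xi i xiv)) etav etav
  (expand xi xiv) (fun _ _ _ _ _ => erefl) ac cp Wp).
rewrite (conn_suml _ oW Wi (fun i => sv xi i xiv) etav ac cp Wp) /field_sum summxE.
apply: eq_bigr => i _.
rewrite (conn_scalel D oW Wi (cs xi i xiv) (dv i) etav ac cp Wp) mxE; congr (_ * _).
rewrite (conn_local D oW Wi (dv i) (dv i) etav (vector_field_sum _ (fun j => sv eta j etav))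
  (fun _ _ _ _ _ => erefl) (expand eta etav) ac cp Wp).
rewrite (conn_sumr _ oW Wi (dv i) (fun j => sv eta j etav) ac cp Wp) /field_sum summxE.
under eq_bigr => j _.
  rewrite (conn_leibniz D oW Wi (cs eta j etav) (dv i) (dv j) ac cp Wp).
  rewrite dir_deriv_coord// coord_fieldE// 3!mxE unit_vecE.
  over.
rewrite big_split /= addrC; congr (_ + _).
rewrite (bigD1 k)//= eqxx mulr1 big1 ?addr0// => j jk.
by rewrite eq_sym (negbTE jk) mulr0.
Qed.

Lemma smooth_conn_coef c k i j : atlas c ->
  smooth_in_chart c (dom c `&` int) (conn_coef D c k i j).
Proof.
move=> ac; have dv l : vector_field (dom c `&` int) (coord_field c l).
  by apply: vector_field_subset (vector_field_coord l ac) => p [].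
have oW : open (dom c `&` int).
  by apply: openI; [exact: dom_open | exact: interior_points_open].
have Wi : dom c `&` int `<=` int by move=> p [].
by have [s _] := conn_vector_field D oW Wi (dv i) (dv j); exact: s.
Qed.

(** The one-form on [W] with prescribed components in one chart. *)
Lemma one_form_of_chart c W (u : 'I_n.+1 -> M -> R) : atlas c -> open W ->
  W `<=` dom c -> (forall k, smooth_in_chart c W (u k)) ->
  one_form W (fun c' p => \row_i \sum_k partial c' i (fun q => c q 0 k) p * u k p).
Proof.
move=> ac oW Wc us; split=> [c' ac' i|c1 c2 p ac1 ac2 c1p c2p Wp i].
  have s k : smooth_in_chart c' W
      (fun p => partial c' i (fun q => c q 0 k) p * u k p).
    apply: smooth_in_chartM.
      apply: smooth_in_chart_subset (fun p _ => @Wc p) _.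
      apply: smooth_in_chart_partial; first exact: dom_open.
      exact: smooth_in_chart_transition.
    exact: (smooth_fun_of_chart ac Wc (us k) ac').
  by apply: smooth_in_chart_eq (smooth_in_chart_sum _ s) => p _ _; rewrite mxE.
rewrite mxE; under [RHS]eq_bigr => l _ do rewrite mxE mulr_sumr.
rewrite exchange_big /=; apply: eq_bigr => k _.
rewrite (partial_chain i ac1 ac2 (dom_open c) (smooth_in_chart_transition k ac2 ac))//.
  by rewrite mulr_suml; apply: eq_bigr => l _; rewrite mulrA.
exact: Wc.
Qed.

Lemma pairing_change W Ups xi c c' p : atlas c -> atlas c' -> dom c p -> dom c' p ->
  W p -> one_form W Ups -> vector_field W xi ->
  pairing Ups xi c p = pairing Ups xi c' p.
Proof.
move=> ac ac' cp c'p Wp [_ ut] [_ xit]; rewrite /pairing.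
under eq_bigr => i _ do rewrite (ut c c' p ac ac' cp c'p Wp i) mulr_suml.
rewrite exchange_big /=; apply: eq_bigr => k _.
rewrite (xit c c' p ac ac' cp c'p Wp k) mulr_sumr; by apply: eq_bigr => i _; ring.
Qed.

Lemma vector_field_projective_change W Ups xi eta : open W -> W `<=` int ->
  one_form W Ups -> vector_field W xi -> vector_field W eta ->
  vector_field W (projective_change D Ups xi eta).
Proof.
move=> oW Wi Uf xiv etav; have Dv := conn_vector_field D oW Wi xiv etav.
have ps c zeta : atlas c -> vector_field W zeta -> smooth_in_chart c W (pairing Ups zeta c).
  move=> ac [zs _]; apply: smooth_in_chart_sum => i.
  by apply: smooth_in_chartM; [exact: Uf.1 | exact: zs].
split=> [c ac i|c c' p ac ac' cp c'p Wp k].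
  have s := smooth_in_chartD (smooth_in_chartD (Dv.1 c ac i)
    (smooth_in_chartM (ps c xi ac xiv) (etav.1 c ac i)))
    (smooth_in_chartM (ps c eta ac etav) (xiv.1 c ac i)).
  by apply: smooth_in_chart_eq s => p _ _; rewrite !mxE.
rewrite !mxE (Dv.2 c c' p)// (etav.2 c c' p)// (xiv.2 c c' p)//.
rewrite -!(pairing_change ac ac' cp c'p Wp Uf)//.
rewrite !mulr_sumr -!big_split; apply: eq_bigr => i _ /=.
by rewrite !mxE !mulrDl !mulrA.
Qed.

(** The tracefree part is invariant under a projective change: the trace of the
    changed coefficients [Gam] is [gamma_m + (n+2) u_m], so the terms in [u] cancel. *)
Lemma tracefree_coef_change c (u : 'I_n.+1 -> R) (Gam : 'I_n.+1 -> 'I_n.+1 -> 'I_n.+1 -> R)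
    i j k p :
  (forall k i j, Gam k i j =
    conn_coef D c k i j p + u i * (k == j)%:R + u j * (k == i)%:R) ->
  Gam k i j - (n.+2)%:R^-1 * ((\sum_l Gam l i l) * (k == j)%:R +
                              (\sum_l Gam l j l) * (k == i)%:R) =
  tracefree_coef D c k i j p.
Proof.
move=> GE.
have tr m : \sum_l Gam l m l = conn_trace D c m p + (n.+2)%:R * u m.
  under eq_bigr => l _ do rewrite GE eqxx mulr1.
  rewrite !big_split /= -addrA; congr (_ + _).
  rewrite sumr_const card_ord (bigD1 m)//= eqxx mulr1 big1 => [|l lm].
    by rewrite addr0 mulr_natl [RHS]mulrSr.
  by rewrite (negbTE lm) mulr0.
rewrite !tr GE /tracefree_coef.
have nz : (n.+2)%:R != 0 :> R by rewrite pnatr_eq0.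
by field.
Qed.

(** If the projective class extends, the coefficients of the changed connection in a
    small enough chart are components of extendable fields [zeta (i, j)], obtained
    from the coordinate fields cut off by [b]. *)
Lemma projective_extends_tracefree : projective_class_extends D ->
  forall x, boundary_points M x -> exists c : chartM, [/\ atlas c, dom c x &
    forall i j k, extends_smoothly (dom c) (tracefree_coef D c k i j)].
Proof.
move=> ext x bx; have [c0 [ac0 c0x _]] := bx.
have [U [Ups [oU Ux Uf Uext]]] := ext x bx.
pose c1 := chart_restrict c0 oU.
have ac1 : atlas c1 by exact: chart_restrict_atlas.
have [V [b [oV Vx Vc b1 bv]]] := cutoff ac1 (conj c0x Ux : dom c1 x).
pose c2 := chart_restrict c1 oV.
have ac2 : atlas c2 by exact: chart_restrict_atlas.
have c2U : dom c2 `<=` U by move=> p [[]].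
pose xi i := field_scale b (coord_field c1 i).
have xiv i : vector_field setT (xi i) by exact/bv/vector_field_coord.
have /choice[zeta zP] : forall ij : 'I_n.+1 * 'I_n.+1, exists z, vector_field U z /\
    field_eq (U `&` int) z (projective_change D Ups (xi ij.1) (xi ij.2)).
  move=> [i j]; have sT : U `<=` setT by [].
  have [z zv zE] := Uext _ _ (vector_field_subset sT (xiv i)) (vector_field_subset sT (xiv j)).
  by exists z.
exists c2; split=> // i j k.
pose W := dom c2 `&` int.
have oW : open W by apply: openI; [exact: dom_open | exact: interior_points_open].
have Wi : W `<=` int by move=> p [].
pose Gam k i j p := zeta (i, j) c2 p 0 k.
have Gs k' i' j' : smooth_in_chart c2 (dom c2) (Gam k' i' j').
  by apply: smooth_in_chart_subset ((zP (i', j')).1.1 c2 ac2 k') => p _ /c2U.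
have GE p : W p -> forall k i j, Gam k i j p =
    conn_coef D c2 k i j p + Ups c2 p 0 i * (k == j)%:R + Ups c2 p 0 j * (k == i)%:R.
  move=> Wp k' i' j'; have [c2p ip] := Wp; have [c1p Vp] := c2p.
  rewrite /Gam (zP (i', j')).2//; last by split=> //; exact: c2U.
  (* On [W] the cutoff function is [1]. *)
  have xiE l : field_eq W (xi l) (coord_field c2 l).
    by move=> c q _ _ [[_ Vq] _]; rewrite /xi /field_scale b1// scale1r.
  have WU : W `<=` setT by [].
  have xW l := vector_field_subset WU (xiv l).
  have dW l : vector_field W (coord_field c2 l).
    by apply: vector_field_subset (vector_field_coord l ac2) => q [].
  have pE l : pairing Ups (xi l) c2 p = Ups c2 p 0 l.
    rewrite /pairing xiE// coord_fieldE// (bigD1 l)//= big1 => [|m ml].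
      by rewrite unit_vecE eqxx mulr1 addr0.
    by rewrite unit_vecE (negbTE ml) mulr0.
  rewrite /projective_change !pE (conn_local D oW Wi (xW i') (dW i') (xW j') (dW j')
    (xiE i') (xiE j') ac2 c2p Wp).
  by rewrite (xiE i' _ _ ac2 c2p Wp) (xiE j' _ _ ac2 c2p Wp) !coord_fieldE// !mxE !eqxx.
exists (fun p => Gam k i j p + - (n.+2)%:R^-1 *
  ((\sum_l Gam l i l p) * (k == j)%:R + (\sum_l Gam l j l p) * (k == i)%:R)).
  apply: (smooth_fun_of_chart ac2) => //.
  have cst a : smooth_in_chart c2 (dom c2) (fun=> a) by exact: smooth_in_chart_cst.
  apply: smooth_in_chartD => //; apply: smooth_in_chartM => //.
  by apply: smooth_in_chartD; apply: smooth_in_chartM => //; apply: smooth_in_chart_sum => l.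
move=> p c2p ip; rewrite mulNr.
exact: (tracefree_coef_change i j k (GE p (conj c2p ip))).
Qed.

(** Conversely, the one-form with components [- (n+2)^-1 gamma_k] in the chart turns
    the connection coefficients into the functions [Psi]. *)
Lemma tracefree_extends_projective :
  (forall x, boundary_points M x -> exists c : chartM, [/\ atlas c, dom c x &
    forall i j k, extends_smoothly (dom c) (tracefree_coef D c k i j)]) ->
  projective_class_extends D.
Proof.
move=> ext x /ext [c [ac cx cext]].
have /choice[G GP] : forall kij : 'I_n.+1 * 'I_n.+1 * 'I_n.+1, exists g : M -> R,
    smooth_fun (dom c) g /\
    forall p, dom c p -> int p -> g p = tracefree_coef D c kij.1.1 kij.1.2 kij.2 p.
  by move=> [[k i] j]; have [g gs gE] := cext i j k; exists g.
pose W := dom c `&` int.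
have oW : open W by apply: openI; [exact: dom_open | exact: interior_points_open].
have Wi : W `<=` int by move=> p [].
have Wc : W `<=` dom c by move=> p [].
pose u k p : R := - (n.+2)%:R^-1 * conn_trace D c k p.
have us k : smooth_in_chart c W (u k).
  apply: smooth_in_chartM; first exact: smooth_in_chart_cst.
  by apply: smooth_in_chart_sum => l; exact: smooth_conn_coef.
have Uf := one_form_of_chart ac oW Wc us.
pose Ups : field M := fun c' p => \row_i \sum_k partial c' i (fun q => c q 0 k) p * u k p.
exists (dom c), Ups; split=> //; first exact: dom_open.
move=> xi eta xiv etav.
(* The components in [c] of the changed derivative, with [Psi] replaced by its
   extension [G]. *)
pose z k p := \sum_i xi c p 0 i * (partial c i (fun q => eta c q 0 k) p +
  \sum_j eta c p 0 j * G (k, i, j) p).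
have zs k : smooth_fun (dom c) (z k).
  apply: (smooth_fun_of_chart ac) => //; apply: smooth_in_chart_sum => i.
  apply: smooth_in_chartM; first exact: xiv.1.
  apply: smooth_in_chartD.
    by apply: smooth_in_chart_partial; [exact: dom_open | exact: etav.1].
  apply: smooth_in_chart_sum => j; apply: smooth_in_chartM; first exact: etav.1.
  exact: (GP (k, i, j)).1.
pose zeta := field_sum (index_enum _) (fun k => field_scale (z k) (coord_field c k)).
have zv : vector_field (dom c) zeta.
  apply: vector_field_sum => k; apply: vector_fieldZ (zs k) _.
  exact: vector_field_coord.
exists zeta => //.
have xiW := vector_field_subset Wc xiv; have etaW := vector_field_subset Wc etav.
apply: (field_eq_of_chart ac Wc (vector_field_subset Wc zv)) => [|p Wp].
  exact: vector_field_projective_change.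
have [cp ip] := Wp; apply/rowP => k.
have -> : zeta c p 0 k = z k p.
  rewrite summxE (bigD1 k)//= big1 => [|l lk].
    by rewrite mxE coord_fieldE// unit_vecE eqxx mulr1 addr0.
  by rewrite mxE coord_fieldE// unit_vecE eq_sym (negbTE lk) mulr0.
have UpsE i : Ups c p 0 i = u i p.
  rewrite mxE (bigD1 i)//= big1 => [|l li].
    by rewrite partial_coord// eqxx mul1r addr0.
  by rewrite partial_coord// (negbTE li) mul0r.
have psiE i : \sum_j eta c p 0 j * G (k, i, j) p =
    \sum_j eta c p 0 j * conn_coef D c k i j p + u i p * eta c p 0 k +
    (\sum_j u j p * eta c p 0 j) * (k == i)%:R.
  under eq_bigr => j _.
    rewrite (_ : _ * _ = eta c p 0 j * conn_coef D c k i j p +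
      (u i p * eta c p 0 j * (k == j)%:R + u j p * eta c p 0 j * (k == i)%:R)); last first.
      by rewrite (GP (k, i, j)).2// /tracefree_coef /u /=; ring.
    over.
  rewrite !big_split /= -mulr_suml addrA; congr (_ + _ + _).
  rewrite (bigD1 k)//= eqxx mulr1 big1 ?addr0// => j jk.
  by rewrite eq_sym (negbTE jk) mulr0.
rewrite !mxE (conn_in_chart k ac oW Wc Wi xiW etaW Wp) /pairing.
under [X in _ + X * _ + _]eq_bigr => i _ do rewrite UpsE.
under [X in _ + X * _]eq_bigr => i _ do rewrite UpsE.
rewrite /z; under [LHS]eq_bigr => i _.
  rewrite psiE (_ : _ * _ = xi c p 0 i * (partial c i (fun q => eta c q 0 k) p +
      \sum_j eta c p 0 j * conn_coef D c k i j p) +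
    (u i p * xi c p 0 i * eta c p 0 k +
     (\sum_j u j p * eta c p 0 j) * (xi c p 0 i * (k == i)%:R))); last by ring.
  over.
rewrite !big_split /= -mulr_suml addrA; congr (_ + _ + _).
rewrite -mulr_sumr; congr (_ * _); rewrite (bigD1 k)//= eqxx mulr1 big1 ?addr0// => i ik.
by rewrite eq_sym (negbTE ik) mulr0.
Qed.

End Connections.

Theorem proposition2 (R : realType) (n : nat) (M : manifold R n)
    (D : connection M) (D_torsion_free : torsion_free D) :
  projective_class_extends D <->
  (forall x : M, boundary_points M x ->
     exists c : chart R n M,
       [/\ atlas c, dom c x &
         forall i j k : 'I_n.+1,
           extends_smoothly (dom c) (tracefree_coef D c k i j)]).
Proof.
split; first exact: projective_extends_tracefree.
exact: tracefree_extends_projective.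
Qed.
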